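(* Let $p\in(1,2)$ and let $X$ be a $C^2$ smooth real Banach space with a $1$-unconditional basis, such that $X$ reflects disjointness and the second derivative of the norm on $X$ is uniformly bounded on the unit sphere $S_X$. Then every contractive projection on $\ell_p(X)$ is an averaging operator and its range admits a block basis.
   Context: All Banach spaces are over $\mathbb{R}$. Let $Z$ be a Banach space with norm $\|\cdot\|$ and a $1$-unconditional basis $\{e_i\}$. For $x=\sum_i\alpha_ie_i\in Z$ the support is $s(x)=\{i\colon\alpha_i\ne0\}$; $x$ is simple if $s(x)$ is finite. $Z$ is a Banach lattice for the coordinatewise order; $x,y\in Z$ are disjoint if $|x|\wedge|y|=0$, equivalently $s(x)\cap s(y)=\emptyset$. The dual $Z^*$ is a Banach lattice, and $v^*,w^*\in Z^*$ are disjoint if $|v^*|\wedge|w^*|=0$. $S_Z=\{z\in Z\colon\|z\|=1\}$. $Z$ is $C^2$ smooth if its norm is twice continuously (Fréchet) differentiable on $Z\setminus\{0\}$. Reflects disjointness: for $x,y\in Z$ let $N(\alpha)=\|x+\alpha y\|$, $\alpha\in\mathbb{R}$. $Z$ reflects disjointness if for every $x,y\in Z$ with $x\notin\mathrm{span}\{y\}$: (i) $N$ is continuously differentiable (and then $N''$ exists almost everywhere by convexity); (ii) if $x$ and $y$ are not disjoint and $N'(0)=0$, then $N''(\alpha)$ does not converge to $0$ as $\alpha\to0$ along any subset of $[0,1]$ of full (Lebesgue) measure; (iii) if $x$ and $y$ are disjoint and $y$ is simple, then $N'(0)=0$ and $N''(\alpha)$ converges to $0$ as $\alpha\to0$ along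 a subset of $[0,1]$ of full measure. For $X$ with norm $\sigma$ and $1$-unconditional basis $\{e_j\}$, $\ell_p(X)$ is the Banach space of all $x\colon\mathbb{N}\to X$ with $\|x\|=\big(\sum_{k=1}^\infty\sigma(x(k))^p\big)^{1/p}<\infty$. It is equipped with the $1$-unconditional basis $\{e_{ij}\}_{(i,j)}$ (in any ordering), $e_{ij}(k)=e_j$ if $k=i$ and $e_{ij}(k)=0$ otherwise; support, simple, and disjoint in $\ell_p(X)$ refer to this basis. A contractive projection on $Z$ is a linear map $P\colon Z\to Z$ with $P^2=P$ and $\|P\|\le1$. A linear operator $T\colon Z\to Z$ is an averaging operator if there are mutually disjoint elements $\{u_i\}_{i\in I}$ in $Z$ and mutually disjoint elements $\{v_i^*\}_{i\in I}$ in $Z^*$ with $v_i^*(u_j)=0$ for all $i\ne j$ and $Tx=\sum_{i\in I}v_i^*(x)u_i$ for all $x\in Z$. A block basis of a subspace $Y$ is a basis $\{y_i\}_{i=1}^{\dim Y}$ of $Y$ with $y_i$, $y_j$ disjoint for all $i\neq j$. *)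

(* Defs.v *)
From HB Require Import structures.
From mathcomp Require Import all_boot all_order all_algebra finmap.
From mathcomp Require Import all_classical all_reals all_analysis.
From mathcomp.analysis.showcase Require summability.

Set Implicit Arguments.
Unset Strict Implicit.
Unset Printing Implicit Defensive.
Import Order.TTheory GRing.Theory Num.Theory.
Import numFieldNormedType.Exports.

Local Open Scope classical_set_scope.
Local Open Scope ring_scope.

(* [bop V W] is the space of bounded operators; [bop Z R] is the dual Z^*, and
   second Frechet derivatives of f : V -> R live in [bop V (bop V R)]. *)
Section bounded_operators.
Context {R : realType} {V W : normedModType R}.

Definition bop_pred : pred (V -> W) := fun f => `[< linear f /\ continuous f >].

Lemma bop_submod_closed : submod_closed bop_pred.
Proof.
split.
  apply/asboolP; split; first by move=> a x y; rewrite /= scaler0 addr0.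
  by move=> x; exact: cvg_cst.
move=> a f g /asboolP[lf cf] /asboolP[lg cg]; apply/asboolP; split.
  move=> b x y; rewrite /= !fctE lf lg !scalerDr !scalerA (mulrC a b).
  by rewrite -!addrA; congr (_ + _); rewrite addrCA.
move=> x; apply: cvgD; last exact: cg.
by apply: cvgZl_tmp; exact: cf.
Qed.
HB.instance Definition _ := GRing.isSubmodClosed.Build R (V -> W) bop_pred
  bop_submod_closed.

Record bop : Type := Bop { bop_fun :> V -> W; _ : bop_pred bop_fun }.
HB.instance Definition _ := [isSub for bop_fun].
HB.instance Definition _ := [Choice of bop by <:].
HB.instance Definition _ := [SubChoice_isSubLmodule of bop by <:].

Implicit Types f g : bop.

Lemma bop_linear f : linear f.
Proof. by case: f => f /= /asboolP[]. Qed.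
HB.instance Definition _ f :=
  GRing.isLinear.Build R V W *:%R (bop_fun f) (bop_linear f).

Lemma bop_continuous f : continuous f.
Proof. by case: f => f /= /asboolP[]. Qed.

Definition opnorm f : R := sup [set `|f x| | x in [set x : V | `|x| <= 1]].

Let unit_image f := [set `|f x| | x in [set x : V | `|x| <= 1]].

Lemma opnorm_has_sup f : has_sup (unit_image f).
Proof.
split; first by exists `|f 0|, 0 => //=; rewrite normr0.
have /linear_boundedP : bounded_near f (nbhs 0).
  by apply: continuous_linear_bounded; exact: bop_continuous.
move=> /pinfty_ex_gt0[r r0 h].
exists r => _ [x /= x1 <-].
by rewrite (le_trans (h x))// ler_piMr// ltW.
Qed.

Lemma opnorm_ub f x : `|x| <= 1 -> `|f x| <= opnorm f.
Proof. by move=> x1; apply: sup_upper_bound (opnorm_has_sup f) _ _; exists x. Qed.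

Lemma opnorm_le f x : `|f x| <= opnorm f * `|x|.
Proof.
have [->|x0] := eqVneq x 0; first by rewrite raddf0 !normr0 mulr0.
have nx : 0 < `|x| by rewrite normr_gt0.
have := @opnorm_ub f (`|x|^-1 *: x).
rewrite normrZ normfV normr_id mulVf ?gt_eqF// lexx linearZ /= normrZ.
by rewrite normfV normr_id ler_pdivrMl// mulrC; exact.
Qed.

Lemma opnorm_leP f (M : R) : (forall x, `|x| <= 1 -> `|f x| <= M) -> opnorm f <= M.
Proof.
move=> h; apply: ge_sup; first by case: (opnorm_has_sup f).
by move=> _ [x /= x1 <-]; exact: h.
Qed.

Lemma opnormD f g : opnorm (f + g) <= opnorm f + opnorm g.
Proof.
apply: opnorm_leP => x x1.
by rewrite (le_trans (ler_normD (f x) (g x)))// lerD// opnorm_ub.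
Qed.

Lemma opnormZ (a : R) f : opnorm (a *: f) = `|a| * opnorm f.
Proof.
have le b h : opnorm (b *: h) <= `|b| * opnorm h.
  apply: opnorm_leP => x x1.
  by rewrite (_ : (b *: h) x = b *: h x)// normrZ ler_wpM2l// opnorm_ub.
apply/eqP; rewrite eq_le le /=.
have [->|a0] := eqVneq a 0.
  rewrite normr0 mul0r; apply: le_trans (opnorm_ub _ (x := 0) _) => //.
  by rewrite normr0.
have := le a^-1 (a *: f).
by rewrite scalerA mulVf// scale1r normfV ler_pdivlMl// normr_gt0.
Qed.

Lemma opnorm_eq0 f : opnorm f = 0 -> f = 0.
Proof.
move=> f0; apply/val_inj/funext => x; apply/eqP.
by rewrite -normr_le0 (le_trans (opnorm_le f x))// f0 mul0r.
Qed.

HB.instance Definition _ :=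
  Lmodule_isNormed.Build R bop opnormD opnormZ opnorm_eq0.

End bounded_operators.
Arguments bop {R} V W.

(* The argument [1 <= p] of [lpseq] is what makes the norm instance inferable. *)
Section lpseq.
Context {R : realType} (p : R) (p1 : 1 <= p) (X : normedModType R).

Definition lp_sum (x : nat -> X) : \bar R := (\sum_(k <oo) (`|x k| `^ p)%:E)%E.

Lemma lp_sum_ge0 x : (0 <= lp_sum x)%E.
Proof. by apply: nneseries_ge0 => k _ _; rewrite lee_fin powR_ge0. Qed.

Let p0 : 0 < p. Proof. exact: lt_le_trans p1. Qed.

Let LnormE x : ('N[counting]_p%:E [EFin \o (fun k => `|x k|%R)] =
  lp_sum x `^ p^-1)%E.
Proof.
rewrite Lnorm_counting//; congr (_ `^ _)%E; apply: eq_eseriesr => k _ /=.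
by rewrite normr_id.
Qed.

Lemma lp_minkowski x y : (lp_sum (x + y)%R `^ p^-1 <=
  lp_sum x `^ p^-1 + lp_sum y `^ p^-1)%E.
Proof.
rewrite -!LnormE.
apply: le_trans (minkowski_EFin _ _ _ p1) => //.
rewrite !Lnorm_counting//.
apply: gt0_ler_poweR.
- by rewrite invr_ge0 ltW.
- rewrite in_itv; apply/andP; split; last exact: leey.
  by apply: nneseries_ge0 => k _ _; exact: poweR_ge0.
- rewrite in_itv; apply/andP; split; last exact: leey.
  by apply: nneseries_ge0 => k _ _; exact: poweR_ge0.
apply: lee_nneseries => k _; first by move=> _; exact: poweR_ge0.
rewrite /= lee_fin !normr_id ge0_ler_powR ?nnegrE ?(ltW p0)//.
by rewrite [leRHS]ger0_norm ?addr_ge0//; exact: ler_normD.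
Qed.

Lemma lp_sumZ (a : R) x : lp_sum (a *: x)%R = ((`|a| `^ p)%:E * lp_sum x)%E.
Proof.
rewrite /lp_sum -nneseriesZl; last by move=> k _; rewrite lee_fin powR_ge0.
by apply: eq_eseriesr => k _; rewrite /= normrZ powRM// EFinM.
Qed.

Lemma lp_sum0 : lp_sum 0 = 0%E.
Proof. by rewrite /lp_sum eseries0// => k _ _; rewrite normr0 powR0// gt_eqF. Qed.

Definition lpseq_pred (_ : 1 <= p) : pred (nat -> X) := fun x => `[< (lp_sum x < +oo)%E >].

Lemma lpseq_submod_closed : submod_closed (lpseq_pred p1).
Proof.
split; first by apply/asboolP; rewrite lp_sum0 ltry.
move=> a x y /asboolP xo /asboolP yo; apply/asboolP.
have pI0 : p^-1 != 0 by rewrite invr_eq0 gt_eqF.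
suff : (lp_sum (a *: x + y)%R `^ p^-1 < +oo)%E.
  by exact: lty_poweRy.
apply: le_lt_trans (lp_minkowski _ _) _.
apply: lte_add_pinfty; apply: poweR_lty => //.
by rewrite lp_sumZ lte_mul_pinfty// lee_fin powR_ge0.
Qed.
HB.instance Definition _ := GRing.isSubmodClosed.Build R (nat -> X) (lpseq_pred p1)
  lpseq_submod_closed.

Record lpseq (q1 : 1 <= p) : Type :=
  LpSeq { lpseq_fun :> nat -> X; _ : lpseq_pred q1 lpseq_fun }.
HB.instance Definition _ := [isSub for @lpseq_fun p1].
HB.instance Definition _ := [Choice of lpseq p1 by <:].
HB.instance Definition _ := [SubChoice_isSubLmodule of lpseq p1 by <:].

Implicit Types x y : lpseq p1.

Lemma lpseq_fin_num x : lp_sum x \is a fin_num.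
Proof. by case: x => x /= /asboolP xo; rewrite ge0_fin_numE// lp_sum_ge0. Qed.

Definition lpnorm x : R := fine (lp_sum x) `^ p^-1.

Let lpnormE x : (lpnorm x)%:E = (lp_sum x `^ p^-1)%E.
Proof. by rewrite -poweR_EFin fineK// lpseq_fin_num. Qed.

Lemma lpnormD x y : lpnorm (x + y) <= lpnorm x + lpnorm y.
Proof.
have := lp_minkowski (lpseq_fun x) (lpseq_fun y).
rewrite (_ : lpseq_fun x + lpseq_fun y = lpseq_fun (x + y))//.
by rewrite -(lpnormE x) -(lpnormE y) -(lpnormE (x + y)) -EFinD lee_fin.
Qed.

Lemma lpnormZ (a : R) x : lpnorm (a *: x) = `|a| * lpnorm x.
Proof.
rewrite /lpnorm (_ : lpseq_fun (a *: x) = a *: lpseq_fun x)// lp_sumZ.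
rewrite fineM ?lpseq_fin_num//= powRM ?powR_ge0 ?fine_ge0 ?lp_sum_ge0//.
by rewrite -powRrM mulfV ?gt_eqF// powRr1.
Qed.

Lemma lpnorm_eq0 x : lpnorm x = 0 -> x = 0.
Proof.
move=> /powR_eq0_eq0/eqP; rewrite fine_eq0 ?lpseq_fin_num// => /eqP x0.
apply/val_inj/funext => k; apply/eqP; rewrite -normr_eq0; apply/eqP.
apply: (@powR_eq0_eq0 _ _ p); apply/eqP; rewrite eq_le powR_ge0 andbT.
rewrite -lee_fin; have -> : 0%:E = lp_sum x by rewrite x0.
rewrite /lp_sum (@nneseriesD1 R _ k)//.
apply: leeDl; apply: nneseries_ge0 => i _ _.
by rewrite lee_fin powR_ge0.
Qed.

HB.instance Definition _ :=
  Lmodule_isNormed.Build R (lpseq p1) lpnormD lpnormZ lpnorm_eq0.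

Lemma lp_single_subproof (i : nat) (v : X) :
  lpseq_pred p1 (fun k => if k == i then v else 0).
Proof.
apply/asboolP; rewrite /lp_sum.
rewrite (@nneseriesD1 R _ i)//.
rewrite eseries0 ?adde0 ?ltry// => k _ /= /negbTE ->.
by rewrite normr0 powR0// gt_eqF.
Qed.

Definition lp_single (i : nat) (v : X) : lpseq p1 := LpSeq (lp_single_subproof i v).

Definition lp_basis (J : Type) (e : J -> X) (ij : nat * J) : lpseq p1 :=
  lp_single ij.1 (e ij.2).

End lpseq.
Arguments lpseq {R p} X q1.
Arguments lp_single {R p} p1 {X}.
Arguments lp_basis {R p} p1 {X J}.

Section unconditional_basis.
Context {R : realType} {Z : normedModType R} {I : choiceType}.
Implicit Types (e : I -> Z) (x y : Z) (a : I -> R).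
Import summability.

(* The sum is unconditional (limit of the net of finite partial sums), so no
   ordering of the index set is involved. *)
Definition sums_to (u : I -> Z) x : Prop := partial_sum u @ totally --> x.

Definition unconditional_basis e : Prop :=
  forall x, exists! a, sums_to (fun i => a i *: e i) x.

Definition one_unconditional_basis e : Prop :=
  unconditional_basis e /\
  forall (F : {fset I}) (s : I -> bool) a,
    `|\sum_(i <- F) ((-1) ^+ s i * a i) *: e i| = `|\sum_(i <- F) a i *: e i|.

Definition coord e x : I -> R :=
  xget (fun=> 0) [set a | sums_to (fun i => a i *: e i) x].

Definition support_in e x : set I := [set i | coord e x i != 0].

Definition simple_in e x : Prop := finite_set (support_in e x).

Definition disjoint_in e x y : Prop := support_in e x `&` support_in e y = set0.

Definition nonneg e x : Prop := forall i, 0 <= coord e x i.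

Implicit Types v w : bop Z R.

(* Lattice operations of Z^* are characterised as suprema and infima for the
   dual order; they are unique when they exist. *)
Definition dual_le e v w : Prop := forall x, nonneg e x -> v x <= w x.

Definition is_dual_sup e v w s : Prop :=
  [/\ dual_le e v s, dual_le e w s &
      forall t, dual_le e v t -> dual_le e w t -> dual_le e s t].

Definition is_dual_inf e v w s : Prop :=
  [/\ dual_le e s v, dual_le e s w &
      forall t, dual_le e t v -> dual_le e t w -> dual_le e t s].

Definition dual_disjoint e v w : Prop :=
  exists absv absw, [/\ is_dual_sup e v (- v) absv, is_dual_sup e w (- w) absw &
                        is_dual_inf e absv absw 0].

End unconditional_basis.

Section smoothness.
Context {R : realType}.

(* Equal to 0 where f is not differentiable. *)
Definition fderiv {V W : normedModType R} (f : V -> W) (x : V) : bop V W :=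
  xget 0 [set A : bop V W | is_diff x f A].

Definition C2_on {V W : normedModType R} (U : set V) (f : V -> W) : Prop :=
  forall x, U x -> [/\ differentiable f x, differentiable (fderiv f) x &
                       {for x, continuous (fderiv (fderiv f))}].

Definition normf (V : normedModType R) (x : V) : R := `|x|.

Definition C2_smooth (V : normedModType R) : Prop :=
  C2_on [set x : V | x != 0] (@normf V).

Definition bounded_second_derivative_on_sphere (V : normedModType R) : Prop :=
  exists M : R, forall x : V, `|x| = 1 -> `|fderiv (fderiv (@normf V)) x| <= M.

End smoothness.

Section reflects_disjointness.
Context {R : realType}.

(* [derive1n] is total, so existence of N'' on A has to be required; 0^' is the
   filter of deleted neighbourhoods, so the value at 0 is irrelevant. *)
Definition second_derivative_vanishes_along (N : R -> R) (A : set R) : Prop :=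
  (forall t, A t -> derivable (derive1 N) t 1) /\ derive1n 2 N t @[t --> within A 0^'] --> 0.

Definition full_measure_subset01 (A : set R) : Prop :=
  A `<=` `[0, 1] /\ (@lebesgue_measure R).-negligible (`[0, 1] `\` A).

Definition reflects_disjointness {Z : normedModType R} {I : choiceType}
    (e : I -> Z) : Prop :=
  forall x y : Z, ~ (exists c : R, x = c *: y) ->
  let N := fun t : R => `|x + t *: y| in
  [/\ (forall t, derivable N t 1) /\ continuous (derive1 N),
      ~ disjoint_in e x y -> derive1 N 0 = 0 ->
        ~ (exists A, full_measure_subset01 A /\
                     second_derivative_vanishes_along N A) &
      disjoint_in e x y -> simple_in e y ->
        derive1 N 0 = 0 /\
        (exists A, full_measure_subset01 A /\
                   second_derivative_vanishes_along N A)].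

End reflects_disjointness.

Section operators.
Context {R : realType} {Z : normedModType R}.

Definition contractive_projection (P : {linear Z -> Z}) : Prop :=
  (forall x, P (P x) = P x) /\ (forall x, `|P x| <= `|x|).

Definition averaging_operator {I : choiceType} (e : I -> Z)
    (T : {linear Z -> Z}) : Prop :=
  exists (K : choiceType) (u : K -> Z) (v : K -> bop Z R),
    [/\ forall i j, i != j -> disjoint_in e (u i) (u j),
        forall i j, i != j -> dual_disjoint e (v i) (v j),
        forall i j, i != j -> v i (u j) = 0 &
        forall x, sums_to (fun i => v i x *: u i) (T x)].

(* The values of y outside D are irrelevant: D is an initial segment of nat, of
   length dim Y. *)
Definition schauder_basis (Y : set Z) (D : set nat) (y : nat -> Z) : Prop :=
  (forall k, D k -> Y (y k)) /\
  forall x, Y x -> exists! a : nat -> R,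
    (forall k, ~ D k -> a k = 0) /\ series (fun k => a k *: y k) @ \oo --> x.

Definition admits_block_basis {I : choiceType} (e : I -> Z) (Y : set Z) : Prop :=
  exists (D : set nat) (y : nat -> Z),
    [/\ D = setT \/ (exists n, D = `I_n),
        schauder_basis Y D y &
        forall i j, D i -> D j -> i != j -> disjoint_in e (y i) (y j)].

End operators.

(* Main.v *)
(* Let Y be the range of P, sigma the norm of X and, for a, b in X,
     E(a,b) = sigma(a+b)^p - sigma(a)^p - D(sigma^p)(a) b >= 0.
   The bound on the second derivative of sigma gives E(a,b) <= C sigma(b)^p, and,
   for a <> 0, E(a,tb) = O(t^2) = o(t^p); reflection of disjointness turns
   E(a,tb) = o(t^2) into disjointness of a and b (and conversely for basis vectors b),
   and makes lp(X) strictly convex.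
   For x in Y and Pv = 0 the linear part of |x+v|^p - |x|^p vanishes, so contractivity
   compares the sums of the E's.  For x, y in Y, comparing |x+ty|^p with |x+t(y+v)|^p at
   order t^p, where only the rows with x(k) = 0 survive, shows that the restriction of y
   to these rows is in Y.  Then x in Y and e_i disjoint from x imply that P e_i is disjoint
   from x: compare at order t^2 if x does not vanish on the row of e_i; otherwise the part w
   of P e_i on the rows of x is in Y, and D(|.|^p)(w) annihilates both e_i and e_i - P e_i,
   hence w itself.
   Consequently Y is stable under restriction to the supports of its elements, so it is
   spanned by elements supported on disjoint atoms, the coefficients of P along which are
   functionals supported on the same atoms. *)
From Pilot Require Import Defs.
From HB Require Import structures.
From mathcomp Require Import all_boot all_order all_algebra finmap.
From mathcomp Require Import all_classical all_reals all_analysis.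
From mathcomp.analysis.showcase Require summability.
From mathcomp Require Import ring lra.

Set Implicit Arguments.
Unset Strict Implicit.
Unset Printing Implicit Defensive.
Import Order.TTheory GRing.Theory Num.Theory.
Import numFieldNormedType.Exports.
Local Open Scope classical_set_scope.
Local Open Scope ring_scope.

Local Notation coord := Pilot.Defs.coord.

(** * Derivatives along lines *)

Section frechet.
Context {R : realType} {V W : normedModType R}.
Implicit Types (f : V -> W).

(** Differentiability includes continuity of the differential, which is therefore a member of [bop];
    the choice in [fderiv] then never falls back on its default 0. *)
Lemma fderivE f x : differentiable f x -> fderiv f x = 'd f x :> (V -> W).
Proof.
move=> df.
have bP : bop_pred ('d f x : V -> W).
  apply/asboolP; split; first exact: linearP.
  exact: diff_continuous.
have : [set A : bop V W | is_diff x f A] (fderiv f x).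
  rewrite /fderiv; apply: (@xgetPex _ 0 [set A : bop V W | is_diff x f A]).
  by exists (Bop bP); apply: DiffDef.
by move=> [_ /= ->].
Qed.

(** The difference quotients of the two derivatives are literally the same function of the
    increment. *)
Lemma is_derive_affine f (a b : V) (t : R) df :
  is_derive (a + t *: b) b f df -> is_derive t 1 (fun s => f (a + s *: b)) df.
Proof.
have E : (fun h : R => h^-1 *: (((fun s => f (a + s *: b)) \o shift t) (h *: 1)
             - f (a + t *: b))) =
         (fun h : R => h^-1 *: ((f \o shift (a + t *: b)) (h *: b) - f (a + t *: b))).
  apply/funext => h; congr (_ *: (f _ - _)).
  by rewrite /= [h *: 1]mulr1 scalerDl addrCA.
move=> [df1 df2]; split; first by rewrite /derivable E.
by rewrite -df2 /derive E.
Qed.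

Lemma is_derive_fderiv f (a b : V) (t : R) : differentiable f (a + t *: b) ->
  is_derive t 1 (fun s => f (a + s *: b)) (fderiv f (a + t *: b) b).
Proof.
move=> df; apply: is_derive_affine; split; first exact: diff_derivable.
by rewrite deriveE// fderivE.
Qed.

(** Evaluation at a fixed vector as a continuous linear map: composed with [fderiv f], it reduces
    second derivatives along a line to the chain rule. *)
Definition bop_eval (b : V) (A : bop V W) : W := A b.

Lemma bop_eval_linear b : linear (bop_eval b).
Proof. by []. Qed.
HB.instance Definition _ b :=
  GRing.isLinear.Build R (bop V W) W *:%R (bop_eval b) (bop_eval_linear b).

Lemma bop_eval_continuous b : continuous (bop_eval b).
Proof.
apply/linear_bounded_continuous/linear_boundedP.
near=> r => A; rewrite /bop_eval.
rewrite (le_trans (opnorm_le A b))// mulrC ler_wpM2r//.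
exact: (normr_ge0 A).
Unshelve. all: by end_near. Qed.

End frechet.

Lemma is_derive_fderiv_eval {R : realType} {V W : normedModType R} (f : V -> W)
    (a b : V) (t : R) : differentiable (fderiv f) (a + t *: b) ->
  is_derive t 1 (fun s => fderiv f (a + s *: b) b)
    (fderiv (fderiv f) (a + t *: b) b b).
Proof.
move=> df.
have de : differentiable (@bop_eval R V W b) (fderiv f (a + t *: b)).
  by apply: linear_differentiable; exact: bop_eval_continuous.
have dc := differentiable_comp df de.
apply: (@is_derive_affine _ _ _ (bop_eval b \o fderiv f)).
split; first exact: diff_derivable.
rewrite deriveE// diff_comp//= (fderivE df) diff_lin//.
exact: bop_eval_continuous.
Qed.

(** * First- and second-order expansions of real functions *)

Section real_calculus.
Context {R : realType}.
Implicit Types f g h : R -> R.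

Lemma is_derive_expansion f (t d : R) : is_derive t 1 f d ->
  forall e, 0 < e -> exists2 r, 0 < r &
    forall s, `|s| < r -> `|f (t + s) - f t - s * d| <= e * `|s|.
Proof.
move=> [df dv] e e0.
have : (fun h : R => h^-1 *: ((f \o shift t) (h *: 1) - f t)) @ 0^' --> d.
  by rewrite -dv; exact: df.
move=> /cvgrPdist_le /(_ e e0)[r r0 hr]; exists r => // s sr.
have [->|s0] := eqVneq s 0; first by rewrite addr0 subrr mul0r subrr normr0 mulr0.
have := hr s; rewrite /= sub0r normrN => /(_ sr s0).
rewrite [s *: 1]mulr1 [s + t]addrC => hs.
rewrite (_ : _ - _ = - (s * (d - s^-1 *: (f (t + s) - f t)))).
  by rewrite normrN normrM mulrC ler_wpM2r.
rewrite /GRing.scale/= mulrBr mulrA divff// mul1r; ring.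
Qed.

Lemma is_derive_unique f (t d d' : R) :
  is_derive t 1 f d -> is_derive t 1 f d' -> d = d'.
Proof. by move=> [_ <-] [_ <-]. Qed.

Lemma is_derive_le f (d C : R) : is_derive (0 : R) 1 f d ->
  (forall s, 0 < s -> s < 1 -> f s - f 0 <= s * C) -> d <= C.
Proof.
move=> fd hC; rewrite leNgt; apply/negP => Cd.
have e0 : 0 < (d - C) / 2 by lra.
have [r r0 hr] := is_derive_expansion fd e0.
pose s := Num.min r 1 / 2.
have s0 : 0 < s by rewrite divr_gt0// lt_min r0 ltr01.
have m0 : 0 < Num.min r 1 by rewrite lt_min r0 ltr01.
have mr : Num.min r 1 <= r by rewrite ge_min lexx.
have m1 : Num.min r 1 <= 1 by rewrite ge_min lexx orbT.
have sr : s < r by rewrite /s; lra.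
have s1 : s < 1 by rewrite /s; lra.
have := hr s; rewrite (gtr0_norm s0) add0r => /(_ sr).
rewrite ler_norml => /andP[h1 _]; have h2 := hC s s0 s1.
nra.
Qed.

Lemma is_derive_continuous_itv f g (a b : R) :
  (forall t : R, a <= t <= b -> is_derive t 1 f (g t)) ->
  {within `[a, b], continuous f}.
Proof.
move=> fg; apply: derivable_within_continuous => t; rewrite in_itv/= => ht.
by have [] := fg t ht.
Qed.

(** Two applications of the mean value theorem turn the remainder into [h y * x] with 0 < y < x < 1.
    The factor 1/2 of Taylor's formula is given up. *)
Lemma taylor2_le f g h (K : R) : 0 <= K ->
  (forall t : R, 0 <= t <= 1 -> is_derive t 1 f (g t)) ->
  (forall t : R, 0 <= t <= 1 -> is_derive t 1 g (h t)) ->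
  (forall t : R, 0 <= t <= 1 -> h t <= K) -> f 1 - f 0 - g 0 <= K.
Proof.
move=> K0 fg gh hK.
have [x] : exists2 x, x \in `]0, 1[ & f 1 - f 0 = g x * (1 - 0).
  apply: MVT => //; last exact: is_derive_continuous_itv fg.
  by move=> x; rewrite in_itv/= => /andP[? ?]; apply: fg; lra.
rewrite in_itv/= => /andP[x0 x1] ->.
have [y] : exists2 y, y \in `]0, x[ & g x - g 0 = h y * (x - 0).
  apply: MVT => //.
    by move=> y; rewrite in_itv/= => /andP[? ?]; apply: gh; lra.
  by apply: (is_derive_continuous_itv (g := h)) => t /andP[? ?]; apply: gh; lra.
rewrite in_itv/= => /andP[y0 yx]; rewrite !subr0 mulr1 => ->.
have hy : h y <= K by apply: hK; lra.
nra.
Qed.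

(** The second derivative is available at 0 only, so the mean value theorem is applied once, to [f]
    minus its quadratic part; the derivative of this difference is the first-order error of [g] at
    0. *)
Lemma peano2 f g (h0 r : R) : 0 < r ->
  (forall t : R, `|t| < r -> is_derive t 1 f (g t)) -> is_derive (0 : R) 1 g h0 ->
  forall e, 0 < e -> exists2 d, 0 < d & forall t, 0 < t -> t < d ->
    `|f t - f 0 - t * g 0 - t ^+ 2 / 2 * h0| <= e * t ^+ 2.
Proof.
move=> r0 fg gh e e0.
have [d d0 hd] := is_derive_expansion gh e0.
exists (Num.min d r); first by rewrite lt_min d0.
move=> t t0; rewrite lt_min => /andP[td tr].
pose F := fun s : R => f s - s * g 0 - s ^+ 2 / 2 * h0.
have dF s : 0 <= s <= t -> is_derive s 1 F (g s - g 0 - s * h0).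
  move=> /andP[s0 st].
  have fs : is_derive s 1 f (g s) by apply: fg; rewrite ger0_norm//; lra.
  rewrite /F; apply: is_derive_eq.
  by rewrite /GRing.scale/= !mulr1 !mulr0 ; field.
have [x] : exists2 x, x \in `]0, t[ &
    F t - F 0 = (fun s => g s - g 0 - s * h0) x * (t - 0).
  apply: MVT => //; last exact: is_derive_continuous_itv dF.
  by move=> x; rewrite in_itv/= => /andP[? ?]; apply: dF; lra.
rewrite in_itv/= subr0 => /andP[x0 xt].
rewrite /F expr0n/= !mul0r !subr0 => E.
rewrite (_ : _ - _ - _ - _ = f t - t * g 0 - t ^+ 2 / 2 * h0 - f 0); last ring.
rewrite E normrM (gtr0_norm t0).
have := hd x; rewrite (gtr0_norm x0) => /(_ (lt_trans xt td)); rewrite add0r => hx.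
rewrite expr2 mulrA ler_wpM2r ?(ltW t0)// (le_trans hx)// ler_wpM2l ?ltW//.
Qed.

Lemma powR_small (q e : R) : 0 < q -> 0 < e ->
  exists2 d, 0 < d & forall t, 0 < t -> t < d -> t `^ q <= e.
Proof.
move=> q0 e0; exists (e `^ q^-1); first exact: powR_gt0.
move=> t t0 td; have -> : e = (e `^ q^-1) `^ q.
  by rewrite -powRrM mulVf ?gt_eqF// powRr1// ltW.
by rewrite ge0_ler_powR ?nnegrE ?powR_ge0// ltW.
Qed.

End real_calculus.

(** * The p-th power of a smooth norm *)

Section norm_power.
Context {R : realType} (p : R) (p1 : 1 < p) (p2 : p < 2) {X : normedModType R}.
Hypothesis X_C2 : C2_smooth X.
Implicit Types a b z : X.

Let N1 z := fderiv (@normf R X) z.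
Let N2 z := fderiv (fderiv (@normf R X)) z.

(** The differential of the p-th power of the norm. At [z = 0], where [N1] is arbitrary, the factor
    [|z| ^ (p - 1)] gives the correct value 0 because p > 1. *)
Definition pow_deriv z b : R := p * `|z| `^ (p - 1) * N1 z b.
Definition pow_deriv2 z b : R :=
  p * (p - 1) * `|z| `^ (p - 2) * (N1 z b) ^+ 2 + p * `|z| `^ (p - 1) * N2 z b b.
(** The quantity E(a,b) of the overview. *)
Definition pow_rem a b : R := `|a + b| `^ p - `|a| `^ p - pow_deriv a b.

Let p0 : 0 < p. Proof. exact: lt_trans p1. Qed.

Lemma pow_derivD z b c : pow_deriv z (b + c) = pow_deriv z b + pow_deriv z c.
Proof. by rewrite /pow_deriv linearD mulrDr. Qed.

Lemma pow_derivZ z (s : R) b : pow_deriv z (s *: b) = s * pow_deriv z b.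
Proof. by rewrite /pow_deriv linearZ/= mulrCA. Qed.

Lemma pow_deriv0l b : pow_deriv 0 b = 0.
Proof. by rewrite /pow_deriv normr0 powR0 ?mulr0 ?mul0r// subr_eq0 gt_eqF. Qed.

Lemma pow_deriv0r a : pow_deriv a 0 = 0.
Proof. by rewrite -(scale0r 0) pow_derivZ mul0r. Qed.

Lemma pow_rem0l b : pow_rem 0 b = `|b| `^ p.
Proof.
by rewrite /pow_rem pow_deriv0l subr0 add0r normr0 powR0 ?subr0 ?gt_eqF.
Qed.

Lemma pow_rem0r a : pow_rem a 0 = 0.
Proof. by rewrite /pow_rem pow_deriv0r addr0 subrr subr0. Qed.

Lemma is_derive_norm a b (t : R) : a + t *: b != 0 ->
  is_derive t 1 (fun s => `|a + s *: b|) (N1 (a + t *: b) b).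
Proof. by move=> /X_C2[df _ _]; exact: (is_derive_fderiv df). Qed.

Lemma is_derive2_norm a b (t : R) : a + t *: b != 0 ->
  is_derive t 1 (fun s => N1 (a + s *: b) b) (N2 (a + t *: b) b b).
Proof. by move=> /X_C2[_ df _]; exact: is_derive_fderiv_eval. Qed.

Lemma is_derive_pow a b (t : R) : a + t *: b != 0 ->
  is_derive t 1 (fun s => `|a + s *: b| `^ p) (pow_deriv (a + t *: b) b).
Proof.
move=> z0; have d1 := is_derive_norm z0.
have d2 : is_derive `|a + t *: b| 1 (@powR R ^~ p) (p * `|a + t *: b| `^ (p - 1)).
  by apply: is_derive1_powR; rewrite normr_gt0.
exact: is_derive1_comp d2 d1.
Qed.

Lemma is_derive2_pow a b (t : R) : a + t *: b != 0 ->
  is_derive t 1 (fun s => pow_deriv (a + s *: b) b) (pow_deriv2 (a + t *: b) b).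
Proof.
move=> z0; have d1 := is_derive_norm z0; have d2 := is_derive2_norm z0.
have d3 : is_derive `|a + t *: b| 1 (@powR R ^~ (p - 1))
    ((p - 1) * `|a + t *: b| `^ (p - 2)).
  have -> : p - 2 = p - 1 - 1 by ring.
  by apply: is_derive1_powR; rewrite normr_gt0.
have d4 := is_derive1_comp d3 d1.
have d5 := is_deriveM d4 d2.
have d6 := is_deriveZ p d5.
have -> : (fun s => pow_deriv (a + s *: b) b) =
    p *: (((@powR R ^~ (p - 1)) \o (fun s => `|a + s *: b|)) *
          (fun s => N1 (a + s *: b) b)).
  by apply/funext => s; rewrite /pow_deriv !fctE /GRing.scale/= mulrA.
apply: is_derive_eq.
rewrite /pow_deriv2 /GRing.scale/= /N1; ring.
Qed.

Lemma norm_convex a b (s : R) : 0 <= s -> s <= 1 ->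
  `|a + s *: b| <= (1 - s) * `|a| + s * `|a + b|.
Proof.
move=> s0 s1; have -> : a + s *: b = (1 - s) *: a + s *: (a + b).
  by rewrite scalerBl scale1r scalerDr addrA subrK.
apply: (le_trans (ler_normD _ _)).
by rewrite !normrZ (ger0_norm s0) (ger0_norm (_ : 0 <= 1 - s))// subr_ge0.
Qed.

Lemma pow_convex a b (s : R) : 0 <= s -> s <= 1 ->
  `|a + s *: b| `^ p <= (1 - s) * `|a| `^ p + s * `|a + b| `^ p.
Proof.
move=> s0 s1.
apply: (@le_trans _ _ (((1 - s) * `|a| + s * `|a + b|) `^ p)).
  rewrite ge0_ler_powR ?nnegrE ?(ltW p0)//; last exact: norm_convex.
  by rewrite addr_ge0// mulr_ge0// subr_ge0.
have := @convex_powR R p (ltW p1) (Itv01 s0 s1) `|a + b| `|a|.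
rewrite !inE/= !in_itv/= !andbT => /(_ (normr_ge0 _) (normr_ge0 _)) h.
rewrite convRE [X in X `^ _ <= _]convRE /= in h.
by rewrite addrC [leRHS]addrC.
Qed.

(** A convex function lies above its tangents. At [a = 0], where the norm is not differentiable, the
    remainder is [|b| ^ p]. *)
Lemma pow_rem_ge0 a b : 0 <= pow_rem a b.
Proof.
have [->|a0] := eqVneq a 0; first by rewrite pow_rem0l powR_ge0.
rewrite /pow_rem subr_ge0.
have d := @is_derive_pow a b 0; rewrite scale0r addr0 in d.
apply: (is_derive_le (d a0)) => s s0 s1; rewrite scale0r addr0.
have := pow_convex a b (ltW s0) (ltW s1); lra.
Qed.

Lemma pow_remZ_le a b (s : R) : 0 <= s -> s <= 1 ->
  pow_rem a (s *: b) <= s * pow_rem a b.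
Proof.
move=> s0 s1; rewrite /pow_rem pow_derivZ.
have := pow_convex a b s0 s1; lra.
Qed.

Lemma normD1_le z b : z != 0 -> N1 z b <= `|b|.
Proof.
move=> z0; have d := @is_derive_norm z b 0; rewrite scale0r addr0 in d.
apply: (is_derive_le (d z0)) => s s0 s1; rewrite scale0r addr0.
by have := ler_normD z (s *: b); rewrite normrZ (gtr0_norm s0); lra.
Qed.

Lemma normD1_norm z b : z != 0 -> `|N1 z b| <= `|b|.
Proof.
move=> z0; rewrite ler_norml normD1_le// andbT lerNl -linearN.
by rewrite (le_trans (normD1_le _ z0))// normrN.
Qed.

(** Obtained by differentiating [|c z + s b| = c |z + s (b / c)|] at s = 0. *)
Lemma normD1_homog z b (c : R) : 0 < c -> N1 (c *: z) b = N1 z b.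
Proof.
move=> c0; have [->|z0] := eqVneq z 0; first by rewrite scaler0.
have d1 := @is_derive_norm z (c^-1 *: b) 0.
have d2 := @is_derive_norm (c *: z) b 0.
rewrite !scale0r !addr0 in d1 d2.
have d3 : is_derive (0 : R) 1 (fun s => `|c *: z + s *: b|) (c *: N1 z (c^-1 *: b)).
  rewrite (_ : (fun s => _) = c *: (fun s : R => `|z + s *: (c^-1 *: b)|)).
    exact: is_deriveZ (d1 z0).
  apply/funext => s; change (`|c *: z + s *: b| = c * `|z + s *: (c^-1 *: b)|).
  rewrite -[X in X * _](gtr0_norm c0) -normrZ scalerDr !scalerA.
  by rewrite mulrAC divff ?mul1r ?gt_eqF.
have cz0 : c *: z != 0 by rewrite scaler_eq0 negb_or gt_eqF.
rewrite (is_derive_unique (d2 cz0) d3) linearZ/= scalerA.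
by rewrite divff ?scale1r ?gt_eqF.
Qed.

Lemma affine_neq0 a b : a != 0 ->
  exists2 r : R, 0 < r & forall t : R, `|t| < r -> a + t *: b != 0.
Proof.
move=> a0; have na : 0 < `|a| by rewrite normr_gt0.
have nb : 0 < `|b| + 1 by rewrite ltr_wpDl.
exists (`|a| / (`|b| + 1)); first by rewrite divr_gt0.
move=> t; rewrite ltr_pdivlMr// => tr; apply: contraPneq tr => /eqP.
rewrite addr_eq0 => /eqP ->; rewrite normrN normrZ mulrDr mulr1.
by apply/negP; rewrite -leNgt lerDl.
Qed.

Lemma norm_tangent a b (t : R) : a != 0 -> 0 < t ->
  t * N1 a b <= `|a + t *: b| - `|a|.
Proof.
move=> a0 t0; have -> : t * N1 a b = N1 a (t *: b) by rewrite linearZ.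
have d := @is_derive_norm a (t *: b) 0; rewrite scale0r addr0 in d.
apply: (is_derive_le (d a0)) => s s0 s1; rewrite scale0r addr0.
have := norm_convex a (t *: b) (ltW s0) (ltW s1); lra.
Qed.

(** * Upper bounds on the remainder from the bounded second derivative *)

Section bounded.
Variable M : R.
Hypothesis M0 : 0 <= M.
Hypothesis X_D2_bounded : forall x : X, `|x| = 1 -> `|N2 x| <= M.

(** The second derivative of the norm is homogeneous of degree -1, so the bound on the unit sphere
    is transported from [w = z / |z|] to [z]. *)
Lemma normD2_le z b : z != 0 -> N2 z b b <= M * `|b| ^+ 2 / `|z|.
Proof.
move=> z0; set c := `|z|; have c0 : 0 < c by rewrite normr_gt0.
pose w := c^-1 *: z; pose h := c^-1 *: b.
have w1 : `|w| = 1 by rewrite normrZ normfV normr_id mulVf ?gt_eqF.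
have w0 : w != 0 by rewrite -normr_gt0 w1.
have d1 := @is_derive2_norm w h 0.
have d2 := @is_derive2_norm z b 0.
rewrite !scale0r !addr0 in d1 d2.
have d3 : is_derive (0 : R) 1 (fun s => N1 (z + s *: b) b) (c *: N2 w h h).
  rewrite (_ : (fun s => _) = c *: (fun s : R => N1 (w + s *: h) h)).
    exact: is_deriveZ (d1 w0).
  apply/funext => s; change (N1 (z + s *: b) b = c * N1 (w + s *: h) h).
  have -> : N1 (w + s *: h) h = c^-1 * N1 (w + s *: h) b by rewrite linearZ.
  rewrite mulrA divff ?gt_eqF// mul1r -[RHS](normD1_homog _ _ c0) /w /h scalerDr !scalerA.
  by rewrite divff ?gt_eqF// mulrAC divff ?gt_eqF// mul1r scale1r.
rewrite (is_derive_unique (d2 z0) d3).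
have h1 : `|N2 w h h| <= M * `|h| ^+ 2.
  rewrite (le_trans (opnorm_le (N2 w h) h))// expr2 mulrA ler_wpM2r//.
  rewrite (le_trans (opnorm_le (N2 w) h))// ler_wpM2r//.
  exact: X_D2_bounded.
have hb : `|h| = c^-1 * `|b| by rewrite normrZ normfV normr_id.
rewrite /GRing.scale/= (le_trans (ler_wpM2l (ltW c0) (le_trans (ler_norm _) h1)))//.
rewrite hb le_eqVlt; apply/orP; left; apply/eqP; field.
by rewrite gt_eqF.
Qed.

Lemma pow_deriv2_le z b : z != 0 ->
  pow_deriv2 z b <= (p * (p - 1) + p * M) * `|z| `^ (p - 2) * `|b| ^+ 2.
Proof.
move=> z0; rewrite /pow_deriv2 mulrDl mulrDl lerD//.
  apply: ler_wpM2l; first by rewrite !mulr_ge0 ?powR_ge0 ?subr_ge0 ?ltW.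
  by rewrite -(real_normK (num_real (N1 z b))) ler_pXn2r ?nnegrE// normD1_norm.
have -> : `|z| `^ (p - 1) = `|z| `^ (p - 2) * `|z|.
  have -> : p - 1 = (p - 2) + 1 by ring.
  by rewrite powRD ?powRr1// normr_eq0 z0 implybT.
have := normD2_le b z0; rewrite ler_pdivlMr ?normr_gt0// => h.
have q0 : 0 <= p * `|z| `^ (p - 2) by rewrite mulr_ge0 ?powR_ge0 ?ltW.
have := ler_wpM2l q0 h; lra.
Qed.

(** The segment from [a] to [a + b] stays outside the ball of radius [|a| / 2], so Taylor's bound
    applies. On the segment [|z| ^ (p - 2)] is at most [2 ^ (2 - p)] times [|a| ^ (p - 2)], and 4 is
    a generous bound for that factor. *)
Lemma pow_rem_quadratic a b : a != 0 -> 2 * `|b| <= `|a| ->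
  pow_rem a b <= 4 * (p * (p - 1) + p * M) * `|a| `^ (p - 2) * `|b| ^+ 2.
Proof.
move=> a0 ab.
have K0 : 0 <= p * (p - 1) + p * M.
  by rewrite addr_ge0// mulr_ge0// ?subr_ge0 ltW.
have na : 0 < `|a| by rewrite normr_gt0.
have zge t : 0 <= t <= 1 -> `|a| / 2 <= `|a + t *: b|.
  move=> /andP[t0 t1].
  have := lerB_normD a (t *: b); rewrite normrZ (ger0_norm t0).
  have := normr_ge0 b; nra.
have z0 t : 0 <= t <= 1 -> a + t *: b != 0.
  by move=> /zge h; rewrite -normr_gt0 (lt_le_trans _ h)// divr_gt0.
have := @taylor2_le R (fun s => `|a + s *: b| `^ p)
  (fun s => pow_deriv (a + s *: b) b) (fun s => pow_deriv2 (a + s *: b) b)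
  (4 * (p * (p - 1) + p * M) * `|a| `^ (p - 2) * `|b| ^+ 2).
rewrite /= scale0r addr0 scale1r; apply.
- by rewrite !mulr_ge0// ?powR_ge0.
- by move=> t t01; apply: is_derive_pow; exact: z0.
- by move=> t t01; apply: is_derive2_pow; exact: z0.
move=> t t01; rewrite (le_trans (pow_deriv2_le _ (z0 t t01)))//.
rewrite ler_wpM2r ?sqr_ge0// -[4 * _]mulrC -mulrA ler_wpM2l//.
set z := a + _.
have q0 : 0 < 2 - p by rewrite subr_gt0.
have nz : 0 < `|z| by rewrite normr_gt0 z0.
have E x : x `^ (p - 2) = (x `^ (2 - p))^-1.
  by rewrite -powRN; congr (_ `^ _); ring.
have hA : `|a| `^ (2 - p) <= 4 * `|z| `^ (2 - p).
  have -> : `|a| = 2 * (`|a| / 2) by field.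
  rewrite powRM ?divr_ge0// ler_pM ?powR_ge0//.
    have q1 : 2 - p <= 1 by rewrite lerBlDr -lerBlDl (_ : 2 - 1 = 1) ?(ltW p1)//; ring.
    have h2 : (2 : R) `^ (2 - p) <= 2 `^ 1 by rewrite ler_powR ?ler1n.
    by move: h2; rewrite powRr1//; lra.
  by rewrite ge0_ler_powR ?nnegrE ?divr_ge0 ?(ltW q0)// zge.
rewrite !E ler_pdivlMr ?powR_gt0// ler_pdivrMl ?powR_gt0//; lra.
Qed.

(** If [2 |b| <= |a|], the quadratic bound suffices, since [|a| ^ (p - 2) <= |b| ^ (p - 2)].
    Otherwise the terms are compared with [|b| ^ p] separately: the constant 13 is 9 for
    [|a + b| ^ p], as [3 ^ p <= 9], plus 4 for the derivative. *)
Lemma pow_rem_le a b :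
  pow_rem a b <= (4 * (p * (p - 1) + p * M) + 13) * `|b| `^ p.
Proof.
have K0 : 0 <= 4 * (p * (p - 1) + p * M).
  by rewrite mulr_ge0// addr_ge0// mulr_ge0// ?subr_ge0 ltW.
set K := 4 * _ in K0 *.
have B0 := powR_ge0 `|b| p.
have [->|a0] := eqVneq a 0; first by rewrite pow_rem0l; nra.
have [b0|b0] := eqVneq b 0.
  by rewrite b0 pow_rem0r normr0 powR0 ?mulr0// gt_eqF.
have na : 0 < `|a| by rewrite normr_gt0.
have nb : 0 < `|b| by rewrite normr_gt0.
have q0 : 0 < 2 - p by rewrite subr_gt0.
have [ab|ab] := leP (2 * `|b|) `|a|.
  rewrite (le_trans (pow_rem_quadratic a0 ab))// -/K -mulrA.
  suff : `|a| `^ (p - 2) * `|b| ^+ 2 <= `|b| `^ p by nra.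
  have -> : `|b| `^ p = `|b| `^ (p - 2) * `|b| ^+ 2.
    by rewrite -powR_mulrn// -powRD ?subrK// gt_eqF// implybT.
  rewrite ler_wpM2r ?sqr_ge0//.
  have E x : x `^ (p - 2) = (x `^ (2 - p))^-1 :> R.
    by rewrite -powRN; congr (_ `^ _); ring.
  rewrite !E lef_pV2 ?posrE ?powR_gt0// ge0_ler_powR ?nnegrE ?(ltW q0)//.
  lra.
have h1 : `|a + b| `^ p <= 9 * `|b| `^ p.
  apply: (@le_trans _ _ ((3 * `|b|) `^ p)).
    rewrite ge0_ler_powR ?nnegrE ?mulr_ge0 ?(ltW p0)//.
    by rewrite (le_trans (ler_normD _ _))//; lra.
  rewrite powRM// ler_wpM2r//.
  have h2 : (3 : R) `^ p <= 3 `^ 2 by rewrite ler_powR ?ler1n ?(ltW p2).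
  by move: h2; rewrite powR_mulrn//; lra.
have h2 : - pow_deriv a b <= 4 * `|b| `^ p.
  have g1 : `|a| `^ (p - 1) <= 2 * `|b| `^ (p - 1).
    apply: (@le_trans _ _ ((2 * `|b|) `^ (p - 1))).
      by rewrite ge0_ler_powR ?nnegrE ?mulr_ge0 ?subr_ge0 ?(ltW p1) ?(ltW ab).
    rewrite powRM// ler_wpM2r ?powR_ge0//.
    have q1 : p - 1 <= 1 by rewrite lerBlDr ltW.
    have h2 : (2 : R) `^ (p - 1) <= 2 `^ 1 by rewrite ler_powR ?ler1n.
    by move: h2; rewrite powRr1//; lra.
  have -> : `|b| `^ p = `|b| `^ (p - 1) * `|b|.
    by rewrite -[X in _ * X](powRr1 (normr_ge0 b)) -powRD ?subrK// gt_eqF// implybT.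
  have := normD1_norm b a0; rewrite ler_norml => /andP[g2 _].
  have g3 := powR_ge0 `|a| (p - 1).
  have g4 := powR_ge0 `|b| (p - 1).
  rewrite /pow_deriv.
  have g5 : - (`|a| `^ (p - 1) * N1 a b) <= 2 * (`|b| `^ (p - 1) * `|b|) by nra.
  have g6 : 0 <= `|b| `^ (p - 1) * `|b| by rewrite mulr_ge0.
  have g7 := mulr_ge0 (ltW q0) g6.
  have g8 : 0 <= p * (2 * (`|b| `^ (p - 1) * `|b|) + `|a| `^ (p - 1) * N1 a b).
    by rewrite mulr_ge0 ?(ltW p0)//; lra.
  lra.
have := powR_ge0 `|a| p; rewrite /pow_rem; nra.
Qed.

(** For fixed nonzero [a] the remainder is O(t^2), and [t ^ 2 = t ^ (2 - p) * t ^ p] with 2 - p >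
    0. *)
Lemma pow_rem_row a b : a != 0 -> forall d, 0 < d -> exists2 s, 0 < s &
  forall t, 0 < t -> t < s -> pow_rem a (t *: b) <= d * t `^ p.
Proof.
move=> a0 d d0.
have q0 : 0 < 2 - p by rewrite subr_gt0.
pose K := 4 * (p * (p - 1) + p * M) * `|a| `^ (p - 2) * `|b| ^+ 2.
have K0 : 0 <= K.
  by rewrite !mulr_ge0 ?powR_ge0// addr_ge0// mulr_ge0// ?subr_ge0 ltW.
have K1 : 0 < K + 1 by rewrite ltr_wpDl.
have dK : 0 < d / (K + 1) by rewrite divr_gt0.
have [s s0 hs] := powR_small q0 dK.
have na : 0 < `|a| by rewrite normr_gt0.
have nb : 0 < 2 * (`|b| + 1) by rewrite mulr_gt0// ltr_wpDl.
exists (Num.min s (`|a| / (2 * (`|b| + 1)))); first by rewrite lt_min s0 divr_gt0.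
move=> t t0; rewrite lt_min ltr_pdivlMr// => /andP[ts ta].
have nt : `|t *: b| = t * `|b| by rewrite normrZ gtr0_norm.
have ht : 2 * `|t *: b| <= `|a| by rewrite nt; nra.
rewrite (le_trans (pow_rem_quadratic a0 ht))// nt exprMn.
rewrite (_ : _ * _ = K * t ^+ 2); last by rewrite /K; ring.
have -> : t ^+ 2 = t `^ (2 - p) * t `^ p.
  by rewrite -powR_mulrn ?(ltW t0)// -powRD ?subrK// gt_eqF// implybT.
rewrite mulrA ler_wpM2r ?powR_ge0//.
apply: (@le_trans _ _ (K * (d / (K + 1)))); first by rewrite ler_wpM2l// hs.
by rewrite mulrA ler_pdivrMr//; nra.
Qed.

End bounded.

(** An o(t^2) remainder makes [pow_deriv2 a b] nonpositive. It is a positive multiple of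
    [(N1 a b) ^+ 2] plus a positive multiple of [N2 a b b], and the latter is nonnegative by
    convexity of the norm; hence both vanish. *)
Lemma pow_deriv2_eq0 a b : a != 0 ->
  (forall e, 0 < e -> exists2 d, 0 < d &
     forall t, 0 < t -> t < d -> pow_rem a (t *: b) <= e * t ^+ 2) ->
  N1 a b = 0 /\ N2 a b b = 0.
Proof.
move=> a0 small.
have [r r0 z0] := affine_neq0 b a0.
have := z0 0; rewrite normr0 => /(_ r0) z00.
have P1 := peano2 r0 (fun t ht => is_derive_pow (z0 t ht)) (is_derive2_pow z00).
have P2 := peano2 r0 (fun t ht => is_derive_norm (z0 t ht)) (is_derive2_norm z00).
rewrite /= scale0r addr0 in P1 P2.
have D2le : pow_deriv2 a b <= 0.
  rewrite leNgt; apply/negP => h.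
  have e0 : 0 < pow_deriv2 a b / 8 by rewrite divr_gt0.
  have [d1 d10 h1] := P1 _ e0; have [d2 d20 h2] := small _ e0.
  pose t := Num.min d1 d2 / 2.
  have m0 : 0 < Num.min d1 d2 by rewrite lt_min d10.
  have m1 : Num.min d1 d2 <= d1 by rewrite ge_min lexx.
  have m2 : Num.min d1 d2 <= d2 by rewrite ge_min lexx orbT.
  have t0 : 0 < t by rewrite divr_gt0.
  have t1 : t < d1 by rewrite /t; lra.
  have t2 : t < d2 by rewrite /t; lra.
  have := h2 t t0 t2; rewrite /pow_rem pow_derivZ => h3.
  have := h1 t t0 t1; rewrite ler_norml => /andP[h4 _].
  have t20 : 0 < t ^+ 2 by rewrite exprn_gt0.
  nra.
(* A negative value would push the norm below its tangent at small t > 0. *)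
have N2ge : 0 <= N2 a b b.
  rewrite leNgt; apply/negP => h.
  have e0 : 0 < - N2 a b b / 4 by rewrite divr_gt0// oppr_gt0.
  have [d1 d10 h1] := P2 _ e0.
  pose t := d1 / 2.
  have t0 : 0 < t by rewrite divr_gt0.
  have t1 : t < d1 by rewrite /t; lra.
  have := h1 t t0 t1; rewrite ler_norml => /andP[_ h4].
  have t20 : 0 < t ^+ 2 by rewrite exprn_gt0.
  have := norm_tangent b a0 t0.
  nra.
have na : 0 < `|a| by rewrite normr_gt0.
have q1 : 0 < p * (p - 1) * `|a| `^ (p - 2).
  by rewrite !mulr_gt0 ?powR_gt0// subr_gt0.
have q2 : 0 < p * `|a| `^ (p - 1) by rewrite mulr_gt0 ?powR_gt0.
rewrite /pow_deriv2 in D2le.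
have s0 := sqr_ge0 (N1 a b).
have N10 : (N1 a b) ^+ 2 = 0 by nra.
split; first by apply/eqP; rewrite -sqrf_eq0 N10.
nra.
Qed.

Lemma pow_rem_little_o a b : a != 0 -> N1 a b = 0 -> N2 a b b = 0 ->
  forall e, 0 < e -> exists2 d, 0 < d &
     forall t, 0 < t -> t < d -> pow_rem a (t *: b) <= e * t ^+ 2.
Proof.
move=> a0 n1 n2 e e0.
have [r r0 z0] := affine_neq0 b a0.
have := z0 0; rewrite normr0 => /(_ r0) z00.
have := peano2 r0 (fun t ht => is_derive_pow (z0 t ht)) (is_derive2_pow z00) e0.
rewrite /= scale0r addr0 => -[d d0 hd]; exists d => // t t0 td.
have := hd t t0 td; rewrite /pow_deriv2 n1 n2 expr0n/= !mulr0 addr0 mulr0 subr0.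
by rewrite /pow_rem pow_derivZ ler_norml => /andP[].
Qed.

End norm_power.

(** * Unconditional bases *)

Section sums.
Import summability finmap.
#[local] Existing Instance totally_filter.
Context {R : realType} {Z : normedModType R} {I : choiceType}.
Implicit Types (u : I -> Z) (x y : Z).

Lemma sums_toP u x : sums_to u x <-> forall e, 0 < e ->
  exists F0 : {fset I}, forall F : {fset I}, (F0 `<=` F)%fset ->
    `|x - \sum_(i <- F) u i| <= e.
Proof.
have E (F : {fset I}) : \sum_(i <- F) u i = partial_sum u F by exact: big_seq_fsetE.
split=> [/cvgrPdist_le h e /h|h].
  by move=> [F0 _ hF]; exists F0 => F /hF; rewrite E.
apply/cvgrPdist_le => e /h[F0 hF]; exists F0 => // F /hF.
by rewrite E.
Qed.

Lemma sums_to_unique u x y : sums_to u x -> sums_to u y -> x = y.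
Proof. by move=> ux uy; exact: cvg_unique ux uy. Qed.

Lemma sums_toD u (v : I -> Z) x y : sums_to u x -> sums_to v y -> sums_to (u + v) (x + y).
Proof.
move=> ux vy; rewrite /sums_to.
have -> : partial_sum (u + v) = partial_sum u + partial_sum v.
  by apply/funext => F; rewrite !fctE /partial_sum -big_split.
exact: cvgD.
Qed.

Lemma sums_toZ u (c : R) x : sums_to u x -> sums_to (c *: u) (c *: x).
Proof.
move=> ux; rewrite /sums_to.
have -> : partial_sum (c *: u) = c *: partial_sum u.
  by apply/funext => F; rewrite !fctE /partial_sum -scaler_sumr.
exact: cvgZl_tmp.
Qed.

Lemma sums_to_single (i : I) (z : Z) : sums_to (fun j => if j == i then z else 0) z.
Proof.
apply/sums_toP => e e0; exists [fset i]%fset => F; rewrite fsub1set => iF.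
rewrite (big_fsetD1 i)//= eqxx big1_fset ?addr0 ?subrr ?normr0 ?ltW// => j.
by rewrite !inE => /andP[/negbTE ->].
Qed.

End sums.

(** * Sign changes and coordinate restrictions for a 1-unconditional basis *)

Section unconditional.
Import summability finmap.
#[local] Existing Instance totally_filter.
Context {R : realType} {X : completeNormedModType R} {J : choiceType} (e : J -> X).
Hypothesis e_basis : one_unconditional_basis e.
Implicit Types (x y : X) (s : J -> bool).

Lemma coord_sums x : sums_to (fun i => coord e x i *: e i) x.
Proof.
apply: (@xgetPex _ (fun=> 0) [set a | sums_to (fun i => a i *: e i) x]).
by have [a [ha _]] := e_basis.1 x; exists a.
Qed.

Arguments coord_sums : clear implicits.

Lemma coord_unique x (a : J -> R) :
  sums_to (fun i => a i *: e i) x -> coord e x = a.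
Proof.
move=> ax; have [b [_ hb]] := e_basis.1 x.
by rewrite -(hb _ ax) -(hb _ (coord_sums x)).
Qed.

Lemma coord_linear (c : R) x y i : coord e (c *: x + y) i = c * coord e x i + coord e y i.
Proof.
have := sums_toD (sums_toZ (c := c) (coord_sums x)) (coord_sums y).
rewrite (_ : _ + _ = fun i => (c * coord e x i + coord e y i) *: e i).
  by move=> /coord_unique ->.
by apply/funext => j; rewrite !fctE scalerDl scalerA.
Qed.

Lemma coord_sub x y i : coord e (x - y) i = coord e x i - coord e y i.
Proof. by rewrite addrC -scaleN1r coord_linear mulN1r addrC. Qed.

Lemma coord_zero i : coord e 0 i = 0.
Proof. by rewrite -(subrr 0) coord_sub subrr. Qed.

Lemma coord_add x y i : coord e (x + y) i = coord e x i + coord e y i.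
Proof. by rewrite -[x]scale1r coord_linear mul1r scale1r. Qed.

Lemma coord_scale (c : R) x i : coord e (c *: x) i = c * coord e x i.
Proof. by rewrite -[c *: x]addr0 coord_linear coord_zero addr0. Qed.

Lemma coord_inj x y : coord e x =1 coord e y -> x = y.
Proof.
move=> /funext xy; apply: (sums_to_unique (coord_sums x)).
by rewrite xy; exact: coord_sums.
Qed.

Lemma coord_delta i j : coord e (e i) j = (j == i)%:R.
Proof.
rewrite (@coord_unique _ (fun k => (k == i)%:R))//.
have := @sums_to_single R X J i (e i); congr (sums_to _ _); apply/funext => k.
by case: eqVneq => [->|_]; rewrite ?scale1r ?scale0r.
Qed.

Lemma basis_neq0 i : e i != 0.
Proof.
apply/eqP => ei; have := coord_delta i i.
by rewrite eqxx ei coord_zero => /esym/eqP; rewrite oner_eq0.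
Qed.

(** Finite sums keep their norm under sign changes, so the flipped partial sums are Cauchy along
    with the original ones. Completeness gives the limit, and equality of norms passes to it. *)
Lemma flip_ex s x : exists y, (forall i, coord e y i = (-1) ^+ s i * coord e x i) /\
  `|y| = `|x|.
Proof.
pose u i := coord e x i *: e i.
pose v i := ((-1) ^+ s i * coord e x i) *: e i.
have uv (F : {fset J}) : `|\sum_(i <- F) v i| = `|\sum_(i <- F) u i|.
  exact: e_basis.2.
have ux := coord_sums x; rewrite -/u in ux.
have SE (w : J -> X) (F : {fset J}) : partial_sum w F = \sum_(i <- F) w i.
  by apply/esym; exact: big_seq_fsetE.
have v_cvg : cvg (partial_sum v @ totally).
  apply: cauchy_cvg; apply: cauchy_exP => d d0.
  have d3 : 0 < d / 3 by rewrite divr_gt0.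
  have [F0 hF0] := (sums_toP _ _).1 ux _ d3.
  exists (partial_sum v F0), F0 => // F /= F0F.
  rewrite -ball_normE/= !SE.
  have split (w : J -> X) :
      \sum_(i <- F) w i = \sum_(i <- F0) w i + \sum_(i <- (F `\` F0)%fset) w i.
    rewrite (big_fsetID _ (mem F0) F)/=; congr (_ + _).
      by apply: congr_big => //; apply: congr1; apply/fsetP => i; rewrite !inE andbC;
         case: (boolP (i \in F0)) => //= /(fsubsetP F0F).
    by apply: congr_big => //; apply: congr1; apply/fsetP => i; rewrite !inE andbC.
  rewrite split opprD addrA subrr sub0r normrN uv.
  have -> : \sum_(i <- (F `\` F0)%fset) u i =
      (x - \sum_(i <- F0) u i) - (x - \sum_(i <- F) u i).
    by rewrite (split u); rewrite opprB addrC addrA subrK addrAC subrr add0r.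
  have h1 := hF0 _ (fsubset_refl F0); have h2 := hF0 _ F0F.
  by rewrite (le_lt_trans (ler_normB _ _))//; lra.
have [y vy] : exists y, sums_to v y by exists (lim (partial_sum v @ totally)).
exists y; split; first by rewrite (coord_unique vy).
have n1 : (fun F => `|partial_sum v F|) @ totally --> `|y| by exact: cvg_norm.
have n2 : (fun F => `|partial_sum u F|) @ totally --> `|x| by exact: cvg_norm.
have E : (fun F => `|partial_sum v F|) = (fun F => `|partial_sum u F|).
  by apply/funext => F; rewrite !SE uv.
by rewrite E in n1; exact: cvg_unique n1 n2.
Qed.

(** The basis projection onto the indices in [s], specified by its coordinates. It exists as the
    mean of [x] and the vector obtained by changing the signs of [x] off [s]. *)
Definition restr s x : X :=
  xget 0 [set y | forall i, coord e y i = if s i then coord e x i else 0].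

Lemma coord_restr s x i : coord e (restr s x) i = if s i then coord e x i else 0.
Proof.
apply: (@xgetPex _ 0 [set y | forall i, coord e y i = if s i then coord e x i else 0]).
have [y [hy _]] := flip_ex (negb \o s) x.
exists (2^-1 *: (x + y)) => j; rewrite coord_scale coord_add hy/=.
by case: (s j); rewrite /= ?expr0 ?expr1; lra.
Qed.

Lemma norm_flip s x : `|restr s x - restr (negb \o s) x| = `|x|.
Proof.
have [y [hy <-]] := flip_ex (negb \o s) x; congr `|_|.
apply: coord_inj => i; rewrite coord_sub !coord_restr hy/=.
by case: (s i); rewrite /= ?expr0 ?expr1 ?mul1r ?subr0 ?mulN1r ?sub0r.
Qed.

Lemma norm_restr s x : `|restr s x| <= `|x|.
Proof.
have h : restr s x = 2^-1 *: (x + (restr s x - restr (negb \o s) x)).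
  by apply: coord_inj => i; rewrite coord_scale coord_add coord_sub !coord_restr/=;
     case: (s i) => /=; lra.
rewrite h normrZ gtr0_norm// ler_pdivrMl// (le_trans (ler_normD _ _))//.
by rewrite norm_flip; lra.
Qed.

(** Subtracting the partial sum over [F0] from [x] does not affect a restriction to indices outside
    [F0], and restrictions are contractive. *)
Lemma restr_small x (d : R) : 0 < d -> exists F0 : {fset J},
  forall s, (forall i, i \in F0 -> ~~ s i) -> `|restr s x| <= d.
Proof.
move=> d0; have [F0 hF0] := (sums_toP _ _).1 (coord_sums x) _ d0.
exists F0 => s sF0.
have -> : restr s x = restr s (x - \sum_(i <- F0) coord e x i *: e i).
  apply: coord_inj => i; rewrite !coord_restr; case: ifPn => // si.
  rewrite coord_sub; suff -> : coord e (\sum_(i <- F0) coord e x i *: e i) i = 0.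
    by rewrite subr0.
  have : forall j, j \in enum_fset F0 -> j != i.
    by move=> j jF; apply: contraTneq si => <-; exact: sF0.
  elim: (enum_fset F0) => [_|j r IH h]; first by rewrite big_nil coord_zero.
  rewrite big_cons coord_add IH ?addr0; last by move=> k kr; rewrite h// inE kr orbT.
  by rewrite coord_scale coord_delta eq_sym (negbTE (h j _)) ?mulr0// inE eqxx.
exact: le_trans (norm_restr _ _) (hF0 _ (fsubset_refl _)).
Qed.

Lemma restr_single x i : restr (pred1 i) x = coord e x i *: e i.
Proof.
apply: coord_inj => j; rewrite coord_restr coord_scale coord_delta/=.
by case: eqVneq => [->|_]; rewrite ?mulr1 ?mulr0.
Qed.

Lemma coord_le x i : `|coord e x i| <= `|e i|^-1 * `|x|.
Proof.
have := norm_restr (pred1 i) x; rewrite restr_single normrZ.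
by rewrite ler_pdivlMl ?normr_gt0 ?basis_neq0// mulrC.
Qed.

End unconditional.

(** * Second-order remainders and disjointness *)

Lemma disjoint_inP {R : realType} {Z : normedModType R} {I : choiceType}
    (e : I -> Z) (x y : Z) :
  disjoint_in e x y <-> forall i, coord e x i = 0 \/ coord e y i = 0.
Proof.
split=> [xy i|xy].
  have [|x0] := eqVneq (coord e x i) 0; first by left.
  have [|y0] := eqVneq (coord e y i) 0; first by right.
  have : (support_in e x `&` support_in e y) i by split.
  by rewrite xy.
apply/seteqP; split=> i // [/= x0 y0].
by case: (xy i) => /eqP E; [move/negP: x0|move/negP: y0]; apply.
Qed.

(** Otherwise the interval from 0 to min(d,1), of positive length, would lie in a null set. *)
Lemma full_measure_meets_right {R : realType} (A : set R) :
  full_measure_subset01 A -> forall d, 0 < d -> exists2 t, A t & 0 < t < d.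
Proof.
move=> [_ [N [mN N0 AN]]] d d0; apply: contrapT => h.
pose m : R := Num.min d 1; have m0 : 0 < m by rewrite lt_min d0 ltr01.
have sub : `]0, m[ `<=` `[0, 1] `\` A.
  move=> t /=; rewrite !in_itv/= => /andP[t0]; rewrite lt_min => /andP[td t1].
  split; first by rewrite !ltW.
  by move=> At; apply: h; exists t => //; rewrite t0.
pose B := [set` `]0, m[].
have : (@lebesgue_measure R B <= 0)%E.
  rewrite -N0; apply: le_measure; rewrite ?inE//; last by move=> t /sub /AN.
  exact: measurable_itv.
by rewrite lebesgue_measure_itv/= lte_fin m0 sube0 lee_fin leNgt m0.
Qed.

Lemma pow_norm_eq0 {R : realType} (p : R) {V : normedModType R} (x : V) :
  `|x| `^ p <= 0 -> x = 0.
Proof.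
move=> h; apply/eqP; rewrite -normr_eq0; apply/eqP; apply: (@powR_eq0_eq0 _ _ p).
by apply/eqP; rewrite eq_le h powR_ge0.
Qed.

Section reflection.
Context {R : realType} (p : R) (p1 : 1 < p) (p2 : p < 2).
Context {X : completeNormedModType R} {J : choiceType} (e : J -> X).
Hypothesis e_basis : one_unconditional_basis e.
Hypothesis X_C2 : C2_smooth X.
Hypothesis X_reflects : reflects_disjointness e.
Implicit Types a b : X.

Let N1 (z : X) := fderiv (@normf R X) z.
Let N2 (z : X) := fderiv (fderiv (@normf R X)) z.

Definition pow_rem_small a b : Prop := forall d, 0 < d -> exists2 r, 0 < r &
  forall t, 0 < t -> t < r -> pow_rem p a (t *: b) <= d * t ^+ 2.

Lemma derive1_norm a b (t : R) : a + t *: b != 0 ->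
  derive1 (fun s : R => `|a + s *: b|) t = N1 (a + t *: b) b.
Proof.
move=> h; rewrite derive1E.
exact: (derive_val (is_derive := is_derive_norm X_C2 h)).
Qed.

Lemma normD2_cvg a b : a != 0 -> (fun t : R => N2 (a + t *: b) b b) @ 0 --> N2 a b b.
Proof.
move=> a0; have [_ _ c] := X_C2 a0.
have c1 : (fun t : R => a + t *: b) @ 0 --> a.
  rewrite -[X in _ --> X](addr0 a) -(scale0r b); apply: cvgD; first exact: cvg_cst.
  by apply: cvgZr_tmp; exact: cvg_id.
have c2 : (fun t : R => N2 (a + t *: b)) @ 0 --> N2 a.
  exact: (@cvg_comp _ _ _ (fun t : R => a + t *: b) N2 _ _ _ c1 c).
have c3 : (fun t : R => N2 (a + t *: b) b) @ 0 --> N2 a b.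
  exact: (@cvg_comp _ _ _ _ (bop_eval b) _ _ _ c2 (@bop_eval_continuous _ _ _ b (N2 a))).
exact: (@cvg_comp _ _ _ _ (bop_eval b) _ _ _ c3 (@bop_eval_continuous _ _ _ b (N2 a b))).
Qed.

Lemma disjoint_not_span a b : a != 0 -> disjoint_in e a b ->
  forall c : R, a + c *: b != 0.
Proof.
move=> a0 /disjoint_inP ab c; apply: contra_neq a0 => /eqP.
rewrite addr_eq0 => /eqP E; apply: (coord_inj e_basis) => i.
rewrite coord_zero//; case: (ab i) => // bi.
by rewrite E -scaleNr coord_scale// bi mulr0.
Qed.

Lemma not_span_affine a b : (forall c : R, a + c *: b != 0) ->
  ~ (exists c : R, a = c *: b).
Proof.
by move=> h [c E]; have := h (- c); rewrite E scaleNr subrr eqxx.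
Qed.

(** Clause (iii) of reflection applies because [e j] is simple: N'(0) = 0, and N'' tends to 0 along
    a set of full measure. By continuity of the second derivative N''(0) = 0, and the Peano
    expansion gives o(t^2). *)
Lemma disjoint_basis_small a j : a != 0 -> coord e a j = 0 ->
  pow_rem_small a (e j).
Proof.
move=> a0 aj.
have dj : disjoint_in e a (e j).
  apply/disjoint_inP => i; rewrite coord_delta//.
  by case: (eqVneq i j) => [->|_]; [left|right].
have z0 := disjoint_not_span a0 dj.
have sj : simple_in e (e j).
  suff sub : support_in e (e j) `<=` [set j] by exact: sub_finite_set sub (finite_set1 j).
  move=> i; rewrite /support_in/= coord_delta//.
  by have [->|_] := eqVneq i j; rewrite ?eqxx.
have [_ _ /(_ dj sj)[N10 [A [Afull [_ Alim]]]]] := X_reflects (not_span_affine z0).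
have N1E : derive1 (fun s : R => `|a + s *: e j|) = fun t => N1 (a + t *: e j) (e j).
  by apply/funext => t; exact: derive1_norm.
have N2E t : derive1n 2 (fun s : R => `|a + s *: e j|) t = N2 (a + t *: e j) (e j) (e j).
  rewrite /derive1n/= N1E derive1E.
  exact: (derive_val (is_derive := is_derive2_norm X_C2 (z0 t))).
apply: pow_rem_little_o => //.
  by rewrite N1E scale0r addr0 in N10.
(* Both limits are compared at one common point [t] of the full-measure set. *)
apply/eqP; rewrite -normr_le0; apply/ler_addgt0Pl => d d0; rewrite addr0.
have d2 : 0 < d / 2 by rewrite divr_gt0.
have [r1 r10 h1] := (cvgrPdist_le _ _).1 Alim _ d2.
have [r2 r20 h2] := (cvgrPdist_le _ _).1 (normD2_cvg (b := e j) a0) _ d2.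
have [|t At /andP[t0 tr]] := full_measure_meets_right Afull (d := Num.min r1 r2).
  by rewrite lt_min r10.
move: tr; rewrite lt_min => /andP[tr1 tr2].
have g1 := h1 t; rewrite /= sub0r normrN (gtr0_norm t0) in g1.
have k1 : `|N2 (a + t *: e j) (e j) (e j)| <= d / 2.
  by rewrite -N2E -normrN -sub0r; exact: g1 tr1 (lt0r_neq0 t0) At.
have g2 := h2 t; rewrite /= sub0r normrN (gtr0_norm t0) in g2.
have k2 := g2 tr2.
rewrite -[X in `|X|](subrK (N2 (a + t *: e j) (e j) (e j))).
by rewrite (le_trans (ler_normD _ _))//; lra.
Qed.

(** The o(t^2) remainder gives N'(0) = N''(0) = 0, and N'' is continuous at 0, so it tends to 0
    along all of [0,1]; clause (ii) of reflection excludes this unless [a] and [b] are disjoint. *)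
Lemma small_disjoint a b : a != 0 -> pow_rem_small a b -> disjoint_in e a b.
Proof.
move=> a0 /(pow_deriv2_eq0 p1 X_C2 a0)[n1 n2].
have [sp|nsp] := pselect (exists c : R, a = c *: b).
  (* If [a] were a multiple of [b], then [N1 a a = 0], whereas the tangent inequality in direction
     [- a] gives [N1 a a >= |a|]. *)
  exfalso; have [c E] := sp.
  have : N1 a a = 0 by rewrite [X in N1 a X]E linearZ/= n1 scaler0.
  have := norm_tangent X_C2 a a0 (ltr0Sn R 0) => /=.
  have := norm_tangent X_C2 (- a) a0 (ltr0Sn R 0) => /=.
  rewrite !scale1r subrr normr0 linearN/= -/N1 => h1 _ h2.
  have na : 0 < `|a| by rewrite normr_gt0.
  have h3 : fderiv (@normf R X) a a = 0 by exact: h2.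
  by move: h1; rewrite h3; lra.
apply: contrapT => nd.
have z0 t : a + t *: b != 0.
  apply/eqP => /eqP; rewrite addr_eq0 => /eqP E; apply: nsp.
  by exists (- t); rewrite scaleNr.
have N1E : derive1 (fun s : R => `|a + s *: b|) = fun t => N1 (a + t *: b) b.
  by apply/funext => t; exact: derive1_norm.
have [_ /(_ nd) + _] := X_reflects nsp.
rewrite N1E scale0r addr0 => /(_ n1); apply.
exists `[0, 1]%classic; split.
  by split=> //; rewrite setDv; exact: negligible_set0.
split; first by move=> t _; rewrite N1E; have [] := is_derive2_norm X_C2 (z0 t).
have N2E : derive1n 2 (fun s : R => `|a + s *: b|) = fun t => N2 (a + t *: b) b b.
  apply/funext => t; rewrite /derive1n/= N1E derive1E.
  exact: (derive_val (is_derive := is_derive2_norm X_C2 (z0 t))).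
have L := normD2_cvg (b := b) a0; rewrite -/N2 (n2 : N2 a b b = 0) in L.
rewrite N2E; apply: cvg_trans L; apply: cvg_app => B /= [r r0 hr].
by exists r => // t tr _ _; apply: hr.
Qed.

(** Strict convexity. Adding the expansions for [h] and [- h] cancels the linear parts, so both
    remainders vanish, and they vanish along the whole segments. Disjointness of [h] from [m] and
    from [m + h / 2] then leaves only [h = 0]. *)
Lemma midpoint_rigid (m h : X) :
  `|m + h| `^ p + `|m - h| `^ p <= 2 * `|m| `^ p -> h = 0.
Proof.
move=> mh.
have Ege a b := pow_rem_ge0 p1 X_C2 a b.
have rem0 : pow_rem p m h = 0 /\ pow_rem p m (- h) = 0.
  have := Ege m h; have := Ege m (- h).
  by rewrite /pow_rem -scaleN1r pow_derivZ scaleN1r; split; lra.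
have rem_t a b t : pow_rem p a b = 0 -> 0 <= t -> t <= 1 -> pow_rem p a (t *: b) = 0.
  move=> ab t0 t1; have := pow_remZ_le p1 a b t0 t1; rewrite ab mulr0 => h1.
  by apply/eqP; rewrite eq_le h1 Ege.
have small a b : pow_rem p a b = 0 -> pow_rem_small a b.
  move=> ab d d0; exists 1 => // t t0 t1; rewrite (rem_t _ _ _ ab (ltW t0) (ltW t1)).
  by rewrite mulr_ge0 ?sqr_ge0// ltW.
have [m0|m0] := eqVneq m 0.
  by move: rem0.1; rewrite m0 pow_rem0l// => hp; apply: (pow_norm_eq0 (p := p)); rewrite hp.
have /disjoint_inP d1 := small_disjoint m0 (small _ _ rem0.1).
(* [m] may be disjoint from [h], but then [m + h / 2] is not, unless [h = 0]. *)
pose m' := m + 2^-1 *: h.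
(* The p-th power of the norm is affine from [m] to [m + h], so the two nonnegative remainders at
   the midpoint [m'] add up to 0. *)
have rem1 : pow_rem p m' (2^-1 *: h) = 0.
  have E1 := rem_t m h 2^-1 rem0.1.
  have q0 : 0 <= (2^-1 : R) by rewrite invr_ge0.
  have q1 : (2^-1 : R) <= 1 by rewrite invf_le1 ?ler1n.
  have {}E1 := E1 q0 q1.
  have F1 := rem0.1.
  have G1 := Ege m' (2^-1 *: h); have G2 := Ege m' (- (2^-1 *: h)).
  have hh : m' + 2^-1 *: h = m + h.
    rewrite /m' -addrA -scalerDl (_ : 2^-1 + 2^-1 = 1 :> R) ?scale1r//; lra.
  have hh2 : m' - 2^-1 *: h = m by rewrite /m' addrK.
  have DN b : pow_deriv p m' (- b) = - pow_deriv p m' b.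
    by rewrite -scaleN1r pow_derivZ mulN1r.
  move: E1 F1 G1 G2; rewrite /pow_rem hh hh2 -/m' DN !pow_derivZ.
  lra.
have [m'0|m'0] := eqVneq m' 0.
  by move: rem1; rewrite m'0 pow_rem0l// => hp; have /eqP : 2^-1 *: h = 0 by
    [apply: (pow_norm_eq0 (p := p)); rewrite hp]; rewrite scaler_eq0 invr_eq0 pnatr_eq0 => /eqP.
have /disjoint_inP d2 := small_disjoint m'0 (small _ _ rem1).
apply: (coord_inj e_basis) => i; rewrite coord_zero//.
case: (d1 i) => // mi; have := d2 i; rewrite /m' coord_add// coord_scale// mi add0r.
by case=> /eqP; rewrite mulf_eq0 invr_eq0 pnatr_eq0/= => /eqP.
Qed.

End reflection.

(** * The p-th power of the norm of lp(X) *)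

Section real_series.
Context {R : realType}.
Implicit Types u v : nat -> R.

Lemma series_ge0_ub u l : (forall k, 0 <= u k) -> series u @ \oo --> l ->
  forall n, series u n <= l.
Proof.
move=> u0 ul n; rewrite -(cvg_lim _ ul)//; apply: nondecreasing_cvgn_le.
  by apply: nondecreasing_series => k _ _; exact: u0.
by apply/cvg_ex; exists l.
Qed.

Lemma series_ge0_term u l : (forall k, 0 <= u k) -> series u @ \oo --> l ->
  forall k, u k <= l.
Proof.
move=> u0 ul k; apply: le_trans (series_ge0_ub u0 ul k.+1).
by rewrite /series/= big_nat_recr//= lerDr sumr_ge0.
Qed.

Lemma cvg_series_le u v l m : (forall k, u k <= v k) ->
  series u @ \oo --> l -> series v @ \oo --> m -> l <= m.
Proof.
move=> uv ul vm; rewrite -(cvg_lim _ ul)// -(cvg_lim _ vm)//; apply: ler_lim.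
- by apply/cvg_ex; exists l.
- by apply/cvg_ex; exists m.
by apply: nearW => n; apply: ler_sum.
Qed.

Lemma cvg_series_ub u l m : series u @ \oo --> l ->
  (forall n, series u n <= m) -> l <= m.
Proof.
move=> ul um; rewrite -(cvg_lim _ ul)//; apply: limr_le.
  by apply/cvg_ex; exists l.
exact: nearW.
Qed.

Lemma cvg_seriesD u v l m : series u @ \oo --> l -> series v @ \oo --> m ->
  series (fun k => u k + v k) @ \oo --> l + m.
Proof.
move=> ul vm; rewrite (_ : series _ = series u + series v); first exact: cvgD.
exact: seriesD.
Qed.

Lemma cvg_seriesZ u (c : R) l : series u @ \oo --> l ->
  series (fun k => c * u k) @ \oo --> c * l.
Proof.
move=> ul; rewrite (_ : series _ = fun n => c * series u n); first exact: cvgMr.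
by apply/funext => n; rewrite /series/= mulr_sumr.
Qed.

Lemma cvg_series_unique u (l m : R) : series u @ \oo --> l -> series u @ \oo --> m -> l = m.
Proof. by move=> ul um; exact: cvg_unique ul um. Qed.

Lemma cvg_series0 : @series R (fun=> 0) @ \oo --> (0 : R).
Proof.
rewrite (_ : series _ = cst 0); first exact: cvg_cst.
by apply/funext => n; rewrite /series/= big1.
Qed.

Lemma cvg_series_single (i : nat) (c : R) :
  series (fun k => if k == i then c else 0) @ \oo --> c.
Proof.
apply: cvg_near_cst; exists i.+1 => // n /= i_n.
rewrite /series/= (bigD1_seq i) ?mem_index_iota ?iota_uniq//= eqxx.
by rewrite big1 ?addr0// => k /negbTE ->.
Qed.

End real_series.

Section lp_space.
Context {R : realType} (p : R) (p1 : 1 < p) {X : normedModType R}.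
Notation Z := (lpseq X (ltW p1)).
Implicit Types x y u v : Z.

Let p0 : 0 < p. Proof. exact: lt_trans p1. Qed.

Lemma lpseq_ext x y : (forall k, x k = y k) -> x = y.
Proof. by move=> xy; apply/val_inj/funext. Qed.

Lemma lp_pow_norm x : (`|x| `^ p)%:E = lp_sum p (lpseq_fun x).
Proof.
rewrite -[RHS]fineK ?lpseq_fin_num//; congr (_%:E).
change (lpnorm x `^ p = fine (lp_sum p x)).
rewrite /lpnorm -powRrM mulVf ?gt_eqF// powRr1//.
exact: fine_ge0 (lp_sum_ge0 _ _).
Qed.

(* Failing comparisons of norms would otherwise unfold series of real powers. *)
Opaque lpnorm powR.

Lemma lp_series x : series (fun k => `|x k| `^ p) @ \oo --> `|x| `^ p.
Proof.
have E : (fun n => \sum_(0 <= k < n) (`|x k| `^ p)%:E)%E @ \oo --> (`|x| `^ p)%:E.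
  rewrite lp_pow_norm; apply: is_cvg_nneseries => k _ _.
  by rewrite lee_fin powR_ge0.
have -> : series (fun k => `|x k| `^ p) =
    fine \o (fun n => \sum_(0 <= k < n) (`|x k| `^ p)%:E)%E.
  by apply/funext => n; rewrite /= sumEFin.
exact: fine_cvg E.
Qed.
Arguments lp_series : clear implicits.

Lemma powR_le_inj (s t : R) : 0 <= s -> 0 <= t -> s `^ p <= t `^ p -> s <= t.
Proof.
move=> s0 t0 h; have E (r : R) : 0 <= r -> r = (r `^ p) `^ p^-1.
  by move=> r0; rewrite -powRrM divff ?gt_eqF// powRr1.
rewrite (E _ s0) (E _ t0).
by apply: ge0_ler_powR; rewrite ?nnegrE ?powR_ge0 ?invr_ge0 ?(ltW p0).
Qed.

Lemma powR_le (s t : R) : 0 <= s -> s <= t -> s `^ p <= t `^ p.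
Proof.
move=> s0 st; apply: ge0_ler_powR; rewrite ?nnegrE ?(ltW p0)//.
exact: le_trans s0 st.
Qed.

Lemma lp_norm_dominated x y : (forall k, `|x k| <= `|y k|) -> `|x| <= `|y|.
Proof.
move=> xy; apply: powR_le_inj; [exact: normr_ge0|exact: normr_ge0|].
apply: (cvg_series_le _ (lp_series x) (lp_series y)) => k.
exact: powR_le (normr_ge0 _) (xy k).
Qed.

Lemma lpseq_dominated (y : nat -> X) x : (forall k, `|y k| <= `|x k|) ->
  lpseq_pred (ltW p1) y.
Proof.
move=> yx; apply/asboolP; apply: (@le_lt_trans _ _ (lp_sum p (lpseq_fun x))).
  apply: lee_nneseries => k _; first by move=> _; rewrite lee_fin powR_ge0.
  by rewrite lee_fin powR_le.
by rewrite -lp_pow_norm ltry.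
Qed.

Lemma lp_norm_row x k : `|x k| <= `|x|.
Proof.
have h := series_ge0_term (fun k => powR_ge0 _ _) (lp_series x) k.
exact: powR_le_inj h.
Qed.

End lp_space.
Arguments lp_series {R p p1 X} x.

(** * First-order expansion of the p-th power of the norm of lp(X) *)

Section lp_derivative.
Context {R : realType} (p : R) (p1 : 1 < p) (p2 : p < 2) {X : normedModType R}.
Notation Z := (lpseq X (ltW p1)).
Hypothesis X_C2 : C2_smooth X.
Variable C : R.
Hypothesis pow_rem_leC : forall a b : X, pow_rem p a b <= C * `|b| `^ p.
Hypothesis pow_rem_rowX : forall a b : X, a != 0 -> forall d, 0 < d ->
  exists2 s, 0 < s &
    forall t, 0 < t -> t < s -> pow_rem p a (t *: b) <= d * t `^ p.
Implicit Types x y u v : Z.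

Let C_pow_ge0 (b : X) : 0 <= C * `|b| `^ p.
Proof. exact: le_trans (pow_rem_ge0 p1 X_C2 0 b) (pow_rem_leC 0 b). Qed.

Definition lp_rem x u : R := limn (series (fun k => pow_rem p (x k) (u k))).
(** Defined so that the expansion is exact. That it is the sum of the row derivatives, hence linear
    in [u], follows by subtracting convergent series. *)
Definition lp_deriv x u : R := `|x + u| `^ p - `|x| `^ p - lp_rem x u.

Lemma lp_expansion x u :
  `|x + u| `^ p = `|x| `^ p + lp_deriv x u + lp_rem x u.
Proof. by rewrite /lp_deriv addrC addrA [_ + (_ - _)]addrC subrK addrC subrK. Qed.

(** The rows are nonnegative and dominated by the summable [C * |u k| ^ p]. *)
Lemma lp_rem_series x u :
  series (fun k => pow_rem p (x k) (u k)) @ \oo --> lp_rem x u.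
Proof.
apply: (@series_le_cvg _ _ (fun k => C * `|u k| `^ p)) => [k|k|k|].
- exact: pow_rem_ge0.
- exact: C_pow_ge0.
- exact: pow_rem_leC.
by apply/cvg_ex; exists (C * `|u| `^ p); apply: cvg_seriesZ; exact: lp_series.
Qed.
Arguments lp_rem_series : clear implicits.

Lemma lp_rem_ge0 x u : 0 <= lp_rem x u.
Proof.
apply: (cvg_series_le _ (@cvg_series0 R) (lp_rem_series x u)) => k.
exact: pow_rem_ge0.
Qed.

Lemma lp_rem_le x u : lp_rem x u <= C * `|u| `^ p.
Proof.
by apply: (cvg_series_le _ (lp_rem_series x u) (cvg_seriesZ (c := C) (lp_series u))).
Qed.

Lemma lp_rem_row x u k : pow_rem p (x k) (u k) <= lp_rem x u.
Proof.
apply: (series_ge0_term (u := fun k => pow_rem p (x k) (u k))).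
  by move=> i; exact: pow_rem_ge0.
exact: lp_rem_series.
Qed.

Lemma lp_deriv_series x u :
  series (fun k => pow_deriv p (x k) (u k)) @ \oo --> lp_deriv x u.
Proof.
have h := cvg_seriesD (cvg_seriesD (lp_series (x + u))
  (cvg_seriesZ (c := -1) (lp_series x)))
  (cvg_seriesZ (c := -1) (lp_rem_series x u)).
rewrite !mulN1r -/(lp_deriv x u) in h.
rewrite (_ : (fun k => pow_deriv _ _ _) = (fun k => `|(x + u) k| `^ p +
  -1 * `|x k| `^ p + -1 * pow_rem p (x k) (u k))) //.
apply/funext => k; rewrite /pow_rem !mulN1r (_ : (x + u) k = x k + u k)//.
by rewrite opprB addrC subrK.
Qed.
Arguments lp_deriv_series : clear implicits.

Lemma lp_derivD x u v : lp_deriv x (u + v) = lp_deriv x u + lp_deriv x v.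
Proof.
apply: (cvg_series_unique (lp_deriv_series x (u + v))).
rewrite (_ : (fun k => _) =
    fun k => pow_deriv p (x k) (u k) + pow_deriv p (x k) (v k)).
  exact: cvg_seriesD (lp_deriv_series x u) (lp_deriv_series x v).
by apply/funext => k; rewrite -pow_derivD.
Qed.

Lemma lp_derivZ x (c : R) u : lp_deriv x (c *: u) = c * lp_deriv x u.
Proof.
apply: (cvg_series_unique (lp_deriv_series x (c *: u))).
rewrite (_ : (fun k => _) = fun k => c * pow_deriv p (x k) (u k)).
  exact: cvg_seriesZ (lp_deriv_series x u).
by apply/funext => k; rewrite -pow_derivZ.
Qed.

Lemma lp_derivB x u v : lp_deriv x (u - v) = lp_deriv x u - lp_deriv x v.
Proof. by rewrite -scaleN1r lp_derivD lp_derivZ mulN1r. Qed.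

Lemma lp_deriv_eq x y u v :
  (forall k, pow_deriv p (x k) (u k) = pow_deriv p (y k) (v k)) ->
  lp_deriv x u = lp_deriv y v.
Proof.
move=> E; apply: (cvg_series_unique (lp_deriv_series x u)).
rewrite (_ : (fun k => _) = fun k => pow_deriv p (y k) (v k)); last exact/funext.
exact: lp_deriv_series.
Qed.

Lemma lp_deriv_disjoint x u : (forall k, x k = 0 \/ u k = 0) -> lp_deriv x u = 0.
Proof.
move=> xu; apply: (cvg_series_unique (lp_deriv_series x u)).
rewrite (_ : (fun k => _) = fun=> 0); first exact: cvg_series0.
by apply/funext => k; case: (xu k) => ->; rewrite ?pow_deriv0l ?pow_deriv0r.
Qed.

(** The expansion at [x] with increment [- x] has left side 0 and a nonnegative remainder. *)
Lemma lp_norm_le_deriv x : `|x| `^ p <= lp_deriv x x.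
Proof.
have := lp_expansion x (- x); rewrite subrr normr0 powR0 ?gt_eqF//; last first.
  exact: lt_trans p1.
have := lp_rem_ge0 x (- x); rewrite -scaleN1r lp_derivZ; lra.
Qed.

(** Among the first [K] rows, those where [x] vanishes contribute exactly [t ^ p * |u k| ^ p], and
    each of the others is o(t^p). Here [r] is the part of [u] on the zero rows of [x]. *)
Lemma lp_rem_asymptotic_head x u (r : Z) (K : nat) :
  (forall k, r k = if x k == 0 then u k else 0) ->
  forall d, 0 < d -> exists2 s, 0 < s & forall t, 0 < t -> t < s ->
    series (fun k => pow_rem p (x k) (t *: u k)) K <=
    t `^ p * (series (fun k => `|r k| `^ p) K + d).
Proof.
move=> rE; elim: K => [|K IH] d d0.
  exists 1 => // t t0 _; rewrite /series/= !big_geq// add0r.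
  by rewrite mulr_ge0 ?powR_ge0// ltW.
have d2 : 0 < d / 2 by rewrite divr_gt0.
have [s1 s10 h1] := IH _ d2.
have [s2 s20 h2] : exists2 s, 0 < s & forall t, 0 < t -> t < s ->
    pow_rem p (x K) (t *: u K) <= t `^ p * (`|r K| `^ p + d / 2).
  rewrite rE; case: eqVneq => [->|xK].
    exists 1 => // t t0 _; rewrite pow_rem0l// normrZ gtr0_norm// powRM ?(ltW t0)//.
    by rewrite ler_wpM2l ?powR_ge0// lerDl ltW.
  have [s s0 hs] := pow_rem_rowX (u K) xK d2.
  exists s => // t t0 ts; rewrite (le_trans (hs t t0 ts))// normr0 powR0 ?gt_eqF//.
    by rewrite add0r mulrC.
  exact: lt_trans p1.
exists (Num.min s1 s2); first by rewrite lt_min s10.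
move=> t t0; rewrite lt_min => /andP[ts1 ts2].
have := h1 t t0 ts1; have := h2 t t0 ts2.
rewrite /series/= !big_nat_recr//=; lra.
Qed.

(* Dominated convergence: the rows with [x k != 0] contribute [o(t ^ p)]. *)
Lemma lp_rem_asymptotic x u (r : Z) :
  (forall k, r k = if x k == 0 then u k else 0) ->
  forall d, 0 < d -> exists2 s, 0 < s & forall t, 0 < t -> t < s ->
    lp_rem x (t *: u) <= t `^ p * (`|r| `^ p + d).
Proof.
move=> rE d d0.
have d2 : 0 < d / 2 by rewrite divr_gt0.
have C1 : 0 < `|C| + 1 by rewrite ltr_wpDl.
(* [K] is taken so large that the tail of [u], multiplied by [|C|], costs at most d/2; the summand 1
   keeps the denominator positive. *)
have dC : 0 < d / 2 / (`|C| + 1) by rewrite divr_gt0.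
have [K _ hK] := (cvgrPdist_le _ _).1 (lp_series u) _ dC.
have [s s0 hs] := lp_rem_asymptotic_head K rE d2.
exists s => // t t0 ts.
have hr := series_ge0_ub (fun k => powR_ge0 _ _) (lp_series r) K.
have hu n := series_ge0_ub (fun k => powR_ge0 _ _) (lp_series u) n.
have tp := powR_ge0 t p.
apply: (cvg_series_ub (lp_rem_series x (t *: u))) => n.
have mono : series (fun k => pow_rem p (x k) ((t *: u) k)) n <=
            series (fun k => pow_rem p (x k) ((t *: u) k)) (K + n).
  rewrite /series/= [leRHS](@big_cat_nat _ _ _ n)//= ?leq_addl// lerDl.
  by rewrite sumr_ge0// => k _; exact: pow_rem_ge0.
apply: (le_trans mono).
rewrite /series/= (@big_cat_nat _ _ _ K)//= ?leq_addr//.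
have tail : \sum_(K <= k < K + n) pow_rem p (x k) ((t *: u) k) <=
    t `^ p * (`|C| * (\sum_(K <= k < K + n) `|u k| `^ p)).
  rewrite !mulr_sumr; apply: ler_sum => k _.
  rewrite (le_trans (pow_rem_leC _ _))// (_ : (t *: u) k = t *: u k)//.
  rewrite normrZ gtr0_norm// powRM ?(ltW t0)// mulrCA ler_wpM2l//.
  by rewrite ler_wpM2r ?powR_ge0// ler_norm.
have ut : \sum_(K <= k < K + n) `|u k| `^ p <= d / 2 / (`|C| + 1).
  have aux (A B U c : R) : A + B <= U -> U - A <= c -> B <= c by move=> *; lra.
  have h1 := hu (K + n)%N.
  rewrite /series/= (@big_cat_nat _ _ _ K)//= ?leq_addr// in h1.
  have := hK K (leqnn K); rewrite ler_norml => /andP[_]; exact: aux h1.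
have {}ut : `|C| * (\sum_(K <= k < K + n) `|u k| `^ p) <= d / 2.
  apply: (@le_trans _ _ (`|C| * (d / 2 / (`|C| + 1)))); first by rewrite ler_wpM2l.
  by rewrite mulrA ler_pdivrMr// mulrC ler_wpM2l ?(ltW d2)// lerDl.
have hd := hs t t0 ts; rewrite /series/= in hd hr.
rewrite (le_trans (lerD hd tail))// -mulrDr ler_wpM2l//.
by rewrite -addrA lerD// [X in _ <= X]splitr lerD2l.
Qed.

End lp_derivative.
Arguments lp_rem_series {R p p1 X} X_C2 {C} pow_rem_leC x u.

(** * Contractive projections of lp(X) *)

Section lp_restriction.
Import finmap.
Context {R : realType} (p : R) (p1 : 1 < p).
Context {X : completeNormedModType R} {J : choiceType} (e : J -> X).
Hypothesis e_basis : one_unconditional_basis e.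
Notation Z := (lpseq X (ltW p1)).
Implicit Types (x y : Z) (s : nat * J -> bool).

Let p0 : 0 < p. Proof. exact: lt_trans p1. Qed.

Definition lp_coord x (ij : nat * J) : R := coord e (x ij.1) ij.2.

Lemma lp_restr_subproof s x :
  lpseq_pred (ltW p1) (fun k => restr e (fun j => s (k, j)) (x k)).
Proof. by apply: (lpseq_dominated (x := x)) => k; exact: norm_restr. Qed.

Definition lp_restr s x : Z := LpSeq (lp_restr_subproof s x).

Lemma lp_coord_linear (c : R) x y i :
  lp_coord (c *: x + y) i = c * lp_coord x i + lp_coord y i.
Proof. exact: coord_linear. Qed.

Lemma lp_coord_inj x y : lp_coord x =1 lp_coord y -> x = y.
Proof.
move=> xy; apply: lpseq_ext => k; apply: (coord_inj e_basis) => j.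
exact: xy (k, j).
Qed.

Lemma lp_coord_restr s x i :
  lp_coord (lp_restr s x) i = if s i then lp_coord x i else 0.
Proof. by rewrite /lp_coord coord_restr// -surjective_pairing. Qed.

Lemma lp_norm_flip s x : `|lp_restr s x - lp_restr (negb \o s) x| = `|x|.
Proof.
have E k : `|(lp_restr s x - lp_restr (negb \o s) x) k| = `|x k|.
  exact: (norm_flip e_basis (fun j => s (k, j)) (x k)).
by apply/eqP; rewrite eq_le; apply/andP; split; apply: lp_norm_dominated => k; rewrite E.
Qed.

(** Induction on the number of rows; a single row is handled in X, to precision
    [(d / 2) ^ (1 / p)]. *)
Lemma lp_restr_head_small x (K : nat) (d : R) : 0 < d ->
  exists F0 : {fset nat * J}, forall s, (forall i, i \in F0 -> ~~ s i) ->
    series (fun k => `|lp_restr s x k| `^ p) K <= d.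
Proof.
elim: K d => [|K IH] d d0.
  by exists fset0 => s _; rewrite /series/= big_geq// ltW.
have d2 : 0 < d / 2 by rewrite divr_gt0.
have [F1 h1] := IH _ d2.
have [F2 h2] := restr_small e_basis (x K) (powR_gt0 p^-1 d2).
exists (F1 `|` [fset (K, j) | j in F2])%fset => s sF.
have := h1 s; rewrite /series/= big_nat_recr//= => {}h1.
rewrite (splitr d) lerD//; first by apply: h1 => i iF; apply: sF; rewrite inE iF.
have h3 : `|restr e (fun j => s (K, j)) (x K)| <= (d / 2) `^ p^-1.
  apply: h2 => j jF; apply: sF; rewrite inE; apply/orP; right.
  by apply/imfsetP; exists j.
have -> : d / 2 = ((d / 2) `^ p^-1) `^ p.
  by rewrite -powRrM mulVf ?gt_eqF// powRr1// ltW.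
by apply: ge0_ler_powR h3; rewrite ?nnegrE ?powR_ge0 ?(ltW p0).
Qed.

(** The p-th power of the norm is split at a row [K]: the tail is small by summability whatever [s]
    is, and the head by the choice of [F0]. Each half is at most [d ^ p / 2]. *)
Lemma lp_restr_small x (d : R) : 0 < d ->
  exists F0 : {fset nat * J}, forall s, (forall i, i \in F0 -> ~~ s i) ->
    `|lp_restr s x| <= d.
Proof.
move=> d0; pose d' := d `^ p / 2.
have d'0 : 0 < d' by rewrite divr_gt0// powR_gt0.
have [K _ hK] := (cvgrPdist_le _ _).1 (lp_series x) _ d'0.
have [F0 hF0] := lp_restr_head_small x K d'0.
exists F0 => s /hF0 hs.
apply: (powR_le_inj p1); [exact: normr_ge0|exact: ltW|].
apply: (cvg_series_ub (lp_series (lp_restr s x))) => n.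
apply: (@le_trans _ _ (series (fun k => `|lp_restr s x k| `^ p) (K + n))).
  rewrite /series/= [leRHS](@big_cat_nat _ _ _ n)//= ?leq_addl// lerDl.
  by rewrite sumr_ge0// => k _; exact: powR_ge0.
have tail : \sum_(K <= k < K + n) `|lp_restr s x k| `^ p <= d'.
  apply: (@le_trans _ _ (\sum_(K <= k < K + n) `|x k| `^ p)).
    by apply: ler_sum => k _; apply: (powR_le p1); [exact: normr_ge0|exact: norm_restr].
  have aux (A B U c : R) : A + B <= U -> U - A <= c -> B <= c by move=> *; lra.
  have h1 := series_ge0_ub (fun k => powR_ge0 _ _) (lp_series x) (K + n)%N.
  rewrite /series/= (@big_cat_nat _ _ _ K)//= ?leq_addr// in h1.
  have := hK K (leqnn K); rewrite ler_norml => /andP[_]; exact: aux h1.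
rewrite (splitr (d `^ p)) /series/= (@big_cat_nat _ _ _ K)//= ?leq_addr//.
exact: lerD.
Qed.

Lemma lp_coord_delta i j : lp_coord (lp_basis (ltW p1) e i) j = (j == i)%:R.
Proof.
case: i j => i1 i2 [j1 j2]; rewrite /lp_coord/= xpair_eqE.
by case: eqVneq => _; rewrite ?coord_delta ?coord_zero.
Qed.

Lemma lp_coord_le x i : `|lp_coord x i| <= `|e i.2|^-1 * `|x|.
Proof.
apply: (le_trans (coord_le e_basis _ _)); rewrite ler_wpM2l ?invr_ge0//.
exact: lp_norm_row.
Qed.

Definition lp_rows (q : nat -> bool) x : Z := lp_restr (fun ij => q ij.1) x.

Lemma lp_rowsE q x k : lp_rows q x k = if q k then x k else 0.
Proof.
apply: (coord_inj e_basis) => j; rewrite /lp_rows/= coord_restr//.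
by case: ifP => // _; rewrite coord_zero.
Qed.

End lp_restriction.

(** * Consequences of contractivity for the range in lp(X) *)

Section lp_projection.
Context {R : realType} (p : R) (p1 : 1 < p) (p2 : p < 2).
Context {X : completeNormedModType R} {J : choiceType} (e : J -> X).
Hypothesis e_basis : one_unconditional_basis e.
Hypothesis X_C2 : C2_smooth X.
Hypothesis X_reflects : reflects_disjointness e.
Hypothesis X_D2_bounded : bounded_second_derivative_on_sphere X.
Notation Z := (lpseq X (ltW p1)).
Implicit Types x y u v : Z.

Let p0 : 0 < p. Proof. exact: lt_trans p1. Qed.

Lemma pow_rem_bound : exists C : R,
  (forall a b : X, pow_rem p a b <= C * `|b| `^ p) /\
  (forall a b : X, a != 0 -> forall d, 0 < d -> exists2 s, 0 < s &
    forall t, 0 < t -> t < s -> pow_rem p a (t *: b) <= d * t `^ p).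
Proof.
have [M hM] := X_D2_bounded.
have hM' (x : X) : `|x| = 1 -> `|fderiv (fderiv (@normf R X)) x| <= `|M|.
  by move=> /hM h; exact: le_trans h (ler_norm M).
exists (4 * (p * (p - 1) + p * `|M|) + 13); split.
  by move=> a b; exact: (pow_rem_le p1 p2 X_C2 (normr_ge0 M) hM').
by move=> a b a0 d d0; exact: (pow_rem_row p1 p2 X_C2 (normr_ge0 M) hM').
Qed.

(** Strict convexity of lp(X). The linear parts for [h] and [- h] cancel, so both remainders vanish,
    hence vanish in every row, and each row is rigid in X. *)
Lemma lp_rigid (m h : Z) : `|m + h| <= `|m| -> `|m - h| <= `|m| -> h = 0.
Proof.
have aux (A D r1 r2 : R) : A + D + r1 <= A -> A - D + r2 <= A -> 0 <= r1 ->
  0 <= r2 -> r1 <= 0 /\ r2 <= 0 by move=> *; split; lra.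
have aux2 (A B D F : R) : A - F + D <= 0 -> B - F - D <= 0 -> B + A <= 2 * F.
  by move=> *; lra.
have [C [hC _]] := pow_rem_bound.
move=> h1 h2.
have H1 := powR_le p1 (normr_ge0 _) h1; have H2 := powR_le p1 (normr_ge0 _) h2.
have E1 := lp_expansion m h; have E2 := lp_expansion m (- h).
have DN : lp_deriv m (- h) = - lp_deriv m h.
  by rewrite -scaleN1r (lp_derivZ X_C2 hC) mulN1r.
rewrite DN in E2; rewrite [leLHS]E1 in H1; rewrite [leLHS]E2 in H2.
have g1 := lp_rem_ge0 X_C2 hC m h; have g2 := lp_rem_ge0 X_C2 hC m (- h).
have [r1 r2] := aux _ _ _ _ H1 H2 g1 g2.
apply: lpseq_ext => k; apply: (midpoint_rigid p1 e_basis X_C2 X_reflects (m := m k)).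
have := le_trans (lp_rem_row X_C2 hC m h k) r1.
have := le_trans (lp_rem_row X_C2 hC m (- h) k) r2.
rewrite /pow_rem (_ : (- h) k = - h k)//.
have -> : pow_deriv p (m k) (- h k) = - pow_deriv p (m k) (h k).
  by rewrite -scaleN1r pow_derivZ mulN1r.
rewrite opprK; exact: aux2.
Qed.

Variable P : {linear Z -> Z}.
Hypothesis P_proj : contractive_projection P.

Let PP x : P (P x) = P x. Proof. exact: P_proj.1. Qed.
Let P_le x : `|P x| <= `|x|. Proof. exact: P_proj.2. Qed.

(** Since [P (x + t v) = x], contractivity gives [0 <= t D + O(t^p)] with D the derivative; as p >
    1, D cannot be negative. The same holds for [- v]. *)
Lemma lp_deriv_ker x v : P x = x -> P v = 0 -> lp_deriv x v = 0.
Proof.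
have [C [hC _]] := pow_rem_bound.
have aux (t r L W K : R) : 0 < t -> L < 0 -> 0 <= t * L + r -> r <= t * (W * K) ->
  W * K <= - L / 2 -> False by move=> *; nra.
have tpE (t : R) : 0 < t -> t `^ p = t * t `^ (p - 1).
  move=> t0; rewrite -[X in X * _](powRr1 (ltW t0)) -powRD; last first.
    by rewrite (gt_eqF t0) implybT.
  by rewrite addrC subrK.
move=> Px.
have ge u : P u = 0 -> 0 <= lp_deriv x u.
  move=> Pu; rewrite leNgt; apply/negP => L0.
  pose K := `|C| * `|u| `^ p + 1.
  have K0 : 0 < K by rewrite ltr_wpDl// mulr_ge0// powR_ge0.
  have q0 : 0 < p - 1 by rewrite subr_gt0.
  have d0 : 0 < - lp_deriv x u / 2 / K by rewrite !divr_gt0// oppr_gt0.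
  have [s s0 hs] := powR_small q0 d0.
  have [t t0 ts] : exists2 t : R, 0 < t & t < s by exists (s / 2); lra.
  have := hs t t0 ts; rewrite ler_pdivlMr// => h1.
  have h4 : lp_rem x (t *: u) <= t * (t `^ (p - 1) * K).
    apply: (le_trans (lp_rem_le X_C2 hC x (t *: u))).
    rewrite normrZ gtr0_norm// powRM ?(ltW t0)// tpE//.
    rewrite mulrCA -mulrA; apply: ler_wpM2l; [exact: ltW|apply: ler_wpM2l; [exact: powR_ge0|]].
    apply: (@le_trans _ _ (`|C| * `|u| `^ p)); last by rewrite lerDl.
    by rewrite ler_wpM2r ?powR_ge0// ler_norm.
  have h2 : `|x| `^ p <= `|x + t *: u| `^ p.
    have PE : P (x + t *: u) = x by rewrite linearD linearZ/= Pu scaler0 addr0.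
    by apply: (powR_le p1 (normr_ge0 _)); rewrite -[in leLHS]PE; exact: P_le.
  rewrite [leRHS](lp_expansion x) (lp_derivZ X_C2 hC) -addrA lerDl in h2.
  exact: aux t0 L0 h2 h4 h1.
move=> Pv; apply/eqP; rewrite eq_le ge// andbT -oppr_ge0.
rewrite -mulN1r -(lp_derivZ X_C2 hC); apply: ge.
by rewrite linearZ/= Pv scaler0.
Qed.

Let zero_rows x : Z -> Z := lp_rows e_basis (fun k => x k == 0).

(** Contractivity compares [|x + t y|] with [|x + t (y + v)|]. The linear parts agree by
    [lp_deriv_ker], so the remainders are compared and divided by [t ^ p]: on the left the zero rows
    of [x] give a lower bound, on the right they are all that survives as t tends to 0. *)
Lemma lp_norm_zero_rows x y v : P x = x -> P y = y -> P v = 0 ->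
  `|zero_rows x y| <= `|zero_rows x (y + v)|.
Proof.
have [C [hC hrow]] := pow_rem_bound.
move=> Px Py Pv; apply: (powR_le_inj p1); [exact: normr_ge0|exact: normr_ge0|].
apply/ler_addgt0Pr => d d0.
have rE k : zero_rows x (y + v) k = if x k == 0 then (y + v) k else 0.
  exact: lp_rowsE.
have [s s0 hs] := lp_rem_asymptotic X_C2 hC hrow rE d0.
have [t t0 ts] : exists2 t : R, 0 < t & t < s by exists (s / 2); lra.
have tp : 0 < t `^ p by rewrite powR_gt0.
rewrite -(ler_pM2l tp); apply: le_trans (hs t t0 ts).
apply: (@le_trans _ _ (lp_rem x (t *: y))).
  apply: (cvg_series_le _ (cvg_seriesZ (c := t `^ p) (lp_series (zero_rows x y)))
    (lp_rem_series X_C2 hC x (t *: y))) => k.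
  rewrite lp_rowsE; case: eqVneq => [->|_].
    by rewrite pow_rem0l// (_ : (t *: y) k = t *: y k)// normrZ gtr0_norm// powRM ?(ltW t0).
  rewrite normr0 powR0 ?mulr0 ?gt_eqF//; exact: pow_rem_ge0.
have h : `|x + t *: y| `^ p <= `|x + t *: (y + v)| `^ p.
  apply: (powR_le p1 (normr_ge0 _)).
  have -> : x + t *: y = P (x + t *: (y + v)).
    by rewrite linearD linearZ/= linearD Px Py Pv addr0.
  exact: P_le.
have D0 : lp_deriv x (t *: (y + v)) = lp_deriv x (t *: y).
  by rewrite !(lp_derivZ X_C2 hC) (lp_derivD X_C2 hC) (lp_deriv_ker Px Pv) addr0.
by rewrite [leLHS](lp_expansion x) [leRHS](lp_expansion x) D0 lerD2l in h.
Qed.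

Lemma zero_rowsP x y k : zero_rows x y k = if x k == 0 then y k else 0.
Proof. exact: lp_rowsE. Qed.

(** With [q = P z] and [q'] its part on the zero rows of [x], one has [|q'| <= |q| <= |z|].
    Perturbing [y] by half of [q - z] shows that the midpoint of [z] and [q'] has norm at least
    [|z|]; strict convexity gives [q' = z], and a second use of it gives [q = z]. *)
Lemma range_zero_rows x y : P x = x -> P y = y -> P (zero_rows x y) = zero_rows x y.
Proof.
move=> Px Py; set z := zero_rows x y; pose q := P z; pose q' := zero_rows x q.
have zz : zero_rows x z = z.
  by apply: lpseq_ext => k; rewrite zero_rowsP /z zero_rowsP; case: (x k == 0).
have zD u v : zero_rows x (u + v) = zero_rows x u + zero_rows x v.
  apply: lpseq_ext => k.
  rewrite (_ : (_ + zero_rows x v) k = zero_rows x u k + zero_rows x v k)//.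
  by rewrite !zero_rowsP; case: ifP => _; rewrite ?addr0.
have zZ (c : R) u : zero_rows x (c *: u) = c *: zero_rows x u.
  apply: lpseq_ext => k; rewrite (_ : (c *: zero_rows x u) k = c *: zero_rows x u k)//.
  by rewrite !zero_rowsP; case: ifP => _; rewrite ?scaler0.
have q'q : `|q'| <= `|q|.
  by apply: lp_norm_dominated => k; rewrite zero_rowsP; case: ifP => //; rewrite normr0.
have qz : `|q| <= `|z| by exact: P_le.
have Pv : P (q - z) = 0 by rewrite linearB/= PP subrr.
have half : `|z| <= `|z + 2^-1 *: (q' - z)|.
  have P2 : P (2^-1 *: (q - z)) = 0 by rewrite linearZ/= Pv scaler0.
  have := lp_norm_zero_rows Px Py P2.
  by rewrite zD zZ -scaleN1r zD zZ zz scaleN1r.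
have full : `|z| <= `|q'|.
  have := lp_norm_zero_rows Px Py Pv.
  by rewrite zD -scaleN1r zD zZ zz scaleN1r -/q' addrC subrK.
have zq (m h : Z) : m - h = z -> m + h = q' -> `|z| <= `|m| -> h = 0.
  move=> mz mq zm; apply: (lp_rigid (m := m)).
    by rewrite [X in `|X| <= _]mq; exact: le_trans (le_trans q'q qz) zm.
  by rewrite [X in `|X| <= _]mz; exact: zm.
have zq' : q' = z.
  apply/eqP; rewrite -subr_eq0; apply/eqP.
  have /eqP : 2^-1 *: (q' - z) = 0.
    apply: (zq (z + 2^-1 *: (q' - z))); last exact: half.
      by rewrite addrK.
    rewrite -addrA -scalerDl (_ : 2^-1 + 2^-1 = 1 :> R); last by field.
    by rewrite scale1r addrC subrK.
  by rewrite scaler_eq0 invr_eq0 pnatr_eq0/= => /eqP.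
apply/eqP; rewrite -subr_eq0; apply/eqP; apply: (lp_rigid (m := z)).
  rewrite [X in `|X| <= _](_ : _ = P z); first exact: qz.
  by rewrite addrC subrK.
(* Since [q' = z], the vector [z - (q - z)] is [q] with its part off the zero rows negated, so its
   norm is [|q|]. *)
pose f ij : bool := x (ij : nat * J).1 == 0.
have E : z - (P z - z) = lp_restr e_basis f q - lp_restr e_basis (negb \o f) q.
  apply: lpseq_ext => k; have := zero_rowsP x q k; rewrite -/q' zq' => zk.
  change (z k - (q k - z k) = lp_rows e_basis (fun k => x k == 0) q k -
    lp_rows e_basis (fun k => x k != 0) q k).
  rewrite zk !lp_rowsE; case: (x k == 0) => /=.
    by rewrite subrr.
  by rewrite subr0.
by rewrite [X in `|X| <= _]E [leLHS]lp_norm_flip.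
Qed.

Lemma range_disjoint_basis x (kj : nat * J) : P x = x -> lp_coord e x kj = 0 ->
  forall i, lp_coord e x i = 0 \/ lp_coord e (P (lp_basis (ltW p1) e kj)) i = 0.
Proof.
have [C [hC hrow]] := pow_rem_bound.
case: kj => k j; set y := lp_basis _ _ _; set w := P y => Px xkj.
have yk : y k = e j by rewrite /y/= eqxx.
have yl l : l != k -> y l = 0 by move=> /negbTE lk; rewrite /y/= lk.
have Pv : P (w - y) = 0 by rewrite linearB/= PP subrr.
have [xk0|xk0] := eqVneq (x k) 0.
  pose w0 := zero_rows x w; have Pw0 : P w0 = w0 by exact: (range_zero_rows Px (PP y)).
  pose w1 := w - w0; have Pw1 : P w1 = w1 by rewrite linearB/= PP Pw0.
  have w1E l : w1 l = if x l == 0 then 0 else w l.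
    change (w l - w0 l = if x l == 0 then 0 else w l).
    by rewrite zero_rowsP; case: (x l == 0); rewrite ?subrr ?subr0.
  have w10 : w1 = 0.
    (* [w1] vanishes on row [k], the only nonzero row of [y]. *)
    have L1 : lp_deriv w1 y = 0.
      apply: (lp_deriv_disjoint X_C2 hC) => l; rewrite w1E.
      by have [->|/yl] := eqVneq l k; [left; rewrite xk0 eqxx|right].
    have L2 := lp_deriv_ker Pw1 Pv.
    rewrite (lp_derivB X_C2 hC) L1 subr0 in L2.
    have L3 : lp_deriv w1 w1 = lp_deriv w1 w.
      apply: (lp_deriv_eq X_C2 hC) => l; rewrite !w1E.
      by case: (x l == 0); rewrite ?pow_deriv0l.
    have := lp_norm_le_deriv X_C2 hC w1; rewrite L3 L2.
    by move=> h; exact: (pow_norm_eq0 (p := p) (V := Z)) h.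
  move=> [l i]; have := w1E l; rewrite w10 /lp_coord/=.
  by case: (eqVneq (x l) 0) => [->|_ <-]; [left|right]; rewrite coord_zero.
have sm := disjoint_basis_small p e_basis X_C2 X_reflects xk0 xkj.
(* The o(t^2) bound for [y], which lives on row [k] alone, bounds the total remainder of [w] by
   contractivity, and hence every row of it. *)
have wsm l d : 0 < d -> exists2 r, 0 < r &
    forall t, 0 < t -> t < r -> pow_rem p (x l) (t *: w l) <= d * t ^+ 2.
  move=> /sm[r r0 hr]; exists r => // t t0 tr.
  apply: le_trans (hr t t0 tr).
  apply: (le_trans (lp_rem_row X_C2 hC x (t *: w) l)).
  have h : `|x + t *: w| `^ p <= `|x + t *: y| `^ p.
    apply: (powR_le p1 (normr_ge0 _)).
    have -> : x + t *: w = P (x + t *: y) by rewrite linearD linearZ/= Px.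
    exact: P_le.
  have D0 : lp_deriv x (t *: w) = lp_deriv x (t *: y).
    have := lp_deriv_ker Px Pv; rewrite !(lp_derivZ X_C2 hC) (lp_derivB X_C2 hC).
    by move/eqP; rewrite subr_eq0 => /eqP ->.
  rewrite [leLHS](lp_expansion x) [leRHS](lp_expansion x) D0 lerD2l in h.
  apply: (le_trans h).
  have S1 := lp_rem_series X_C2 hC x (t *: y).
  have S2 := @cvg_series_single R k (pow_rem p (x k) (t *: e j)).
  have SE : (fun i => pow_rem p (x i) ((t *: y) i)) =
      fun i => if i == k then pow_rem p (x k) (t *: e j) else 0.
    apply/funext => i; have [->|ik] := eqVneq i k; first by rewrite -yk.
    by rewrite (_ : (t *: y) i = t *: y i)// yl// scaler0 pow_rem0r.
  by rewrite SE in S1; rewrite (cvg_series_unique S1 S2).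
move=> [l i]; rewrite /lp_coord/=.
have [xl0|xl0] := eqVneq (x l) 0; first by left; rewrite xl0 coord_zero.
have /disjoint_inP := small_disjoint p1 X_C2 X_reflects xl0 (wsm l).
exact.
Qed.

End lp_projection.

(** * From disjointness to averaging operators *)

Section functionals.
Context {R : realType} {Z : normedModType R}.

Lemma bop_of_bound (f : Z -> R) (C : R) : linear f ->
  (forall x, `|f x| <= C * `|x|) -> exists v : bop Z R, forall x, v x = f x.
Proof.
move=> lf hC.
have fB x y : f (x - y) = f x - f y.
  by rewrite -[x - y]addrC -scaleN1r lf scaleN1r addrC.
suff h : bop_pred f by exists (Bop h).
apply/asboolP; split=> // x; apply/cvgrPdist_le => d d0.
have C0 : 0 < `|C| + 1 by rewrite ltr_wpDl.
near=> y; rewrite -fB (le_trans (hC _))//.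
have : `|x - y| <= d / (`|C| + 1).
  by near: y; apply: cvgr_dist_le; [exact: cvg_id|rewrite divr_gt0].
rewrite ler_pdivlMr// => h.
have := ler_wpM2r (normr_ge0 (x - y)) (ler_norm C).
have := normr_ge0 (x - y); lra.
Unshelve. all: by end_near. Qed.

End functionals.

(** * Projections over an abstract system of coordinates [co] and restrictions [rs] *)

Section unconditional_projection.
Import finmap.
Context {R : realType} {Z : normedModType R} {I : countType} (b : I -> Z).
Variable co : Z -> I -> R.
Variable rs : (I -> bool) -> Z -> Z.
Hypothesis co_linear : forall (c : R) x y i, co (c *: x + y) i = c * co x i + co y i.
Hypothesis co_inj : forall x y, co x =1 co y -> x = y.
Hypothesis co_rs : forall s x i, co (rs s x) i = if s i then co x i else 0.
Hypothesis rs_flip : forall s x, `|rs s x - rs (negb \o s) x| = `|x|.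
Hypothesis rs_small : forall x (d : R), 0 < d -> exists F0 : {fset I},
  forall s, (forall i, i \in F0 -> ~~ s i) -> `|rs s x| <= d.
Hypothesis co_delta : forall i j, co (b i) j = (j == i)%:R.
Hypothesis co_le : forall i, exists C : R, forall x, `|co x i| <= C * `|x|.
Implicit Types (x y z : Z) (s : I -> bool) (v w : bop Z R).

Lemma coB x y i : co (x - y) i = co x i - co y i.
Proof. by rewrite addrC -scaleN1r co_linear mulN1r addrC. Qed.

Lemma co0 i : co 0 i = 0.
Proof. by rewrite -(subrr 0) coB subrr. Qed.

Lemma coD x y i : co (x + y) i = co x i + co y i.
Proof. by rewrite -[x]scale1r co_linear mul1r scale1r. Qed.

Lemma coZ (c : R) x i : co (c *: x) i = c * co x i.
Proof. by rewrite -[c *: x]addr0 co_linear co0 addr0. Qed.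

Lemma co_sum (r : seq nat) (f : nat -> Z) i :
  co (\sum_(k <- r) f k) i = \sum_(k <- r) co (f k) i.
Proof.
elim: r => [|k r IH]; first by rewrite !big_nil co0.
by rewrite !big_cons coD IH.
Qed.

Lemma eq_rs s s' x : (forall i, co x i != 0 -> s i = s' i) -> rs s x = rs s' x.
Proof.
move=> h; apply: co_inj => i; rewrite !co_rs.
have [->|/h ->//] := eqVneq (co x i) 0; by case: (s i); case: (s' i).
Qed.

Lemma rs_cover (A : nat -> I -> bool) x (r : seq nat) :
  (forall k l i, A k i -> A l i -> k = l) -> uniq r ->
  x - \sum_(k <- r) rs (A k) x = rs (fun i => ~~ has (A^~ i) r) x.
Proof.
move=> disj ur; apply: co_inj => i; rewrite coB co_sum co_rs.
have [/hasP[k kr Aki]|/hasPn nA] := boolP (has (A^~ i) r).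
  rewrite (bigD1_seq k)//= co_rs Aki big1 ?addr0 ?subrr// => l lk.
  rewrite co_rs ifF//; apply: contra_neqF lk => Ali; exact: disj Ali Aki.
rewrite big_seq big1 ?subr0// => k /nA/= nk.
by rewrite co_rs (negbTE nk).
Qed.

(** For each index of a finite set carrying almost all of [x], one class containing it is selected.
    Any list containing the selected classes leaves a small remainder, which serves both
    unconditional sums and ordinary series. *)
Lemma rs_cover_small (A : nat -> I -> bool) x (d : R) : 0 < d ->
  (forall k l i, A k i -> A l i -> k = l) ->
  (forall i, co x i != 0 -> exists k, A k i) ->
  exists F0 : {fset nat}, forall r, uniq r -> {subset F0 <= r} ->
    `|x - \sum_(k <- r) rs (A k) x| <= d.
Proof.
move=> d0 disj cov; have [F hF] := rs_small x d0.
have [f hf] : {f : I -> nat & forall i, co x i != 0 -> A (f i) i}.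
  apply: (@choice _ _ (fun i k => co x i != 0 -> A k i)) => i.
  have [xi|/cov[k Ak]] := eqVneq (co x i) 0; last by exists k.
  by exists 0%N => /eqP.
exists [fset f i | i in F]%fset => r ur Fr.
rewrite rs_cover//.
(* Intersecting with the support of [x] discards the indices where the value of [f] is only a
   default. *)
rewrite (eq_rs (s' := fun i => ~~ has (A^~ i) r && (co x i != 0))); last first.
  by move=> i ->; rewrite andbT.
apply: hF => i iF; apply/negP => /andP[/hasPn nA xi].
have /Fr/nA : f i \in [fset f i | i in F]%fset by apply/imfsetP; exists i.
by rewrite hf.
Qed.

Lemma sums_to_cover (A : nat -> I -> bool) x :
  (forall k l i, A k i -> A l i -> k = l) ->
  (forall i, co x i != 0 -> exists k, A k i) -> sums_to (fun k => rs (A k) x) x.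
Proof.
move=> disj cov; apply/sums_toP => d d0.
have [F0 hF0] := rs_cover_small d0 disj cov.
by exists F0 => F /fsubsetP F0F; apply: hF0.
Qed.

Lemma series_cover (A : nat -> I -> bool) x :
  (forall k l i, A k i -> A l i -> k = l) ->
  (forall i, co x i != 0 -> exists k, A k i) ->
  series (fun k => rs (A k) x) @ \oo --> x.
Proof.
move=> disj cov; apply/cvgrPdist_le => d d0.
have [F0 hF0] := rs_cover_small d0 disj cov.
exists (\max_(k <- F0) k).+1 => // n /= hn; apply: hF0; first exact: iota_uniq.
move=> k kF; rewrite mem_index_iota/=; apply: leq_trans hn.
by rewrite ltnS; apply: (@leq_bigmax_seq _ _ xpredT id).
Qed.

Lemma sum_basis (a : I -> R) (F : {fset I}) i :
  co (\sum_(j <- F) a j *: b j) i = if i \in F then a i else 0.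
Proof.
have -> : (i \in F) = (i \in enum_fset F) by [].
elim: (enum_fset F) (fset_uniq F) => [_|j r IH /= /andP[jr ur]].
  by rewrite big_nil co0.
rewrite big_cons coD IH// coZ co_delta inE.
have [->|ij] := eqVneq i j; first by rewrite (negbTE jr) mulr1 addr0.
by rewrite mulr0 add0r.
Qed.

Lemma sub_sum_basis x (F : {fset I}) :
  x - \sum_(j <- F) co x j *: b j = rs (fun i => i \notin F) x.
Proof.
apply: co_inj => i; rewrite coB sum_basis co_rs.
by case: (i \in F); rewrite ?subrr ?subr0.
Qed.

Lemma sums_to_basis x : sums_to (fun i => co x i *: b i) x.
Proof.
apply/sums_toP => d d0; have [F0 hF0] := rs_small x d0.
exists F0 => F /fsubsetP F0F; rewrite sub_sum_basis.
by apply: hF0 => i /F0F; rewrite negbK.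
Qed.

Arguments sums_to_basis : clear implicits.

(** Every partial sum whose index set contains [i] has i-th coordinate [a i]; continuity of that
    coordinate then forces [a i = co x i]. *)
Lemma coordE x : coord b x = co x.
Proof.
have uniq_a (a : I -> R) : sums_to (fun i => a i *: b i) x -> a = co x.
  move=> ax; apply/funext => i; apply/eqP; rewrite -subr_eq0 -normr_le0.
  apply/ler_addgt0Pl => d d0; rewrite addr0.
  have [C hC] := co_le i.
  have C1 : 0 < `|C| + 1 by rewrite ltr_wpDl.
  have dC : 0 < d / (`|C| + 1) by rewrite divr_gt0.
  have [F0 hF0] := (sums_toP _ _).1 ax _ dC.
  have := hF0 _ (fsubsetU1 i F0).
  rewrite ler_pdivlMr// => h; have := hC (x - \sum_(j <- (i |` F0)%fset) a j *: b j).
  rewrite coB sum_basis fset1U1 distrC => h2; apply: (le_trans h2).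
  have := ler_wpM2r (normr_ge0 (x - \sum_(j <- (i |` F0)%fset) a j *: b j)) (ler_norm C).
  have := normr_ge0 (x - \sum_(j <- (i |` F0)%fset) a j *: b j); lra.
apply: uniq_a; apply: (@xgetPex _ (fun=> 0) [set a | sums_to (fun i => a i *: b i) x]).
by exists (co x); exact: sums_to_basis.
Qed.

(** * Order and disjointness in the dual *)

Lemma bop_ge0 v x : (forall i, 0 <= co x i * v (b i)) -> 0 <= v x.
Proof.
move=> h; apply/ler_addgt0Pl => d d0.
have C1 : 0 < opnorm v + 1 by rewrite ltr_wpDl//; exact: (normr_ge0 v).
(* By continuity [v x] is within [d] of the value of [v] at a partial sum, which is nonnegative term
   by term. *)
have dC : 0 < d / (opnorm v + 1) by rewrite divr_gt0.
have [F0 hF0] := (sums_toP _ _).1 (sums_to_basis x) _ dC.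
have := hF0 _ (fsubset_refl F0); set S := \sum_(i <- F0) _ => hS.
have vS : 0 <= v S.
  rewrite /S; elim: (enum_fset F0) => [|i r IH]; first by rewrite big_nil linear0.
  by rewrite big_cons linearD/= addr_ge0// linearZ; exact: h.
have := opnorm_le v (x - S); rewrite linearB/= ler_norml => /andP[h1 _].
have n0 := normr_ge0 (x - S).
move: hS; rewrite ler_pdivlMr// => h2.
have : opnorm v * `|x - S| <= d by lra.
lra.
Qed.

Lemma bop_eq0 v x : (forall i, co x i = 0 \/ v (b i) = 0) -> v x = 0.
Proof.
move=> h; apply/eqP; rewrite eq_le -oppr_ge0; apply/andP; split; last first.
  by apply: bop_ge0 => i; case: (h i) => ->; rewrite ?mul0r ?mulr0.
have -> : - v x = v (- x) by rewrite linearN.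
apply: bop_ge0 => i; rewrite -scaleN1r coZ.
by case: (h i) => ->; rewrite ?mul0r ?mulr0 ?mul0r.
Qed.

Lemma rs_linear s : linear (rs s).
Proof.
move=> c x y; apply: co_inj => i; rewrite co_linear !co_rs co_linear.
by case: (s i); rewrite ?mulr0 ?addr0.
Qed.

Lemma rs_basis s i : rs s (b i) = if s i then b i else 0.
Proof.
apply: co_inj => j; rewrite co_rs; have [<-|ij] := eqVneq j i.
  by case: ifP => // _; rewrite co0.
rewrite co_delta (negbTE ij); case: (s j); case: (s i); rewrite ?co0 ?co_delta ?(negbTE ij)//.
Qed.

Definition dual_sign v : I -> bool := fun i => 0 <= v (b i).

(** The modulus is [v] composed with the isometry that changes the signs of the coordinates where
    [v (b i)] is negative. The order relations are then checked on basis vectors. *)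
Lemma dual_abs_ex v : exists s : bop Z R, is_dual_sup b v (- v) s /\
  forall i, s (b i) = `|v (b i)|.
Proof.
pose q := dual_sign v.
have [s hs] : exists s : bop Z R, forall x, s x = v (rs q x - rs (negb \o q) x).
  apply: (bop_of_bound (C := opnorm v)) => [c x y|x].
    by rewrite !rs_linear opprD addrACA -scalerBr linearP.
  by rewrite (le_trans (opnorm_le _ _))// rs_flip.
have sb i : s (b i) = `|v (b i)|.
  rewrite hs !rs_basis /=; case: ifPn => /= [h|h]; rewrite ?sub0r ?subr0.
    by rewrite ger0_norm.
  by rewrite linearN ltr0_norm// ltNge.
exists s; split => //; split.
- move=> x; rewrite /nonneg coordE => x0; rewrite -subr_ge0.
  apply: (bop_ge0 (v := s - v)) => i; rewrite mulr_ge0//.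
  by rewrite (_ : (s - v) (b i) = s (b i) - v (b i))// sb subr_ge0 ler_norm.
- move=> x; rewrite /nonneg coordE => x0; rewrite -subr_ge0.
  apply: (bop_ge0 (v := s - - v)) => i; rewrite mulr_ge0//.
  by rewrite (_ : (s - - v) (b i) = s (b i) - - v (b i))// sb subr_ge0 -normrN ler_norm.
move=> t h1 h2 x; rewrite /nonneg coordE => x0; rewrite -subr_ge0.
apply: (bop_ge0 (v := t - s)) => i; rewrite mulr_ge0//.
rewrite (_ : (t - s) (b i) = t (b i) - s (b i))// sb subr_ge0.
have b0 : nonneg b (b i) by move=> j; rewrite coordE co_delta ler0n.
by rewrite ler_norml lerNl h1// andbT; exact: (h2 _ b0).
Qed.

(** On each basis vector one of the two moduli is 0, so every common lower bound is nonpositive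
    there. *)
Lemma dual_disjointP v w : (forall i, v (b i) = 0 \/ w (b i) = 0) -> dual_disjoint b v w.
Proof.
move=> vw; have [s [hs sb]] := dual_abs_ex v; have [t [ht tb]] := dual_abs_ex w.
exists s, t; split => //; split.
- move=> x; rewrite /nonneg coordE => x0; apply: bop_ge0 => i.
  by rewrite mulr_ge0// sb.
- move=> x; rewrite /nonneg coordE => x0; apply: bop_ge0 => i.
  by rewrite mulr_ge0// tb.
move=> r rs1 rt1 x; rewrite /nonneg coordE => x0.
rewrite -oppr_ge0; apply: (bop_ge0 (v := - r)) => i; rewrite mulr_ge0//.
rewrite (_ : (- r) (b i) = - r (b i))// oppr_ge0.
have b0 : nonneg b (b i) by move=> j; rewrite coordE co_delta ler0n.
case: (vw i) => E.
  by apply: (le_trans (rs1 _ b0)); rewrite sb E normr0.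
by apply: (le_trans (rt1 _ b0)); rewrite tb E normr0.
Qed.

(** * Atoms and blocks of the range *)

Hypothesis rigid : forall m h : Z, `|m + h| <= `|m| -> `|m - h| <= `|m| -> h = 0.
Variable P : {linear Z -> Z}.
Hypothesis P_proj : contractive_projection P.
Hypothesis P_disjoint : forall x i, P x = x -> co x i = 0 ->
  forall j, co x j = 0 \/ co (P (b i)) j = 0.

Let PP x : P (P x) = P x. Proof. exact: P_proj.1. Qed.
Let P_le x : `|P x| <= `|x|. Proof. exact: P_proj.2. Qed.
Let supp x : I -> bool := fun i => co x i != 0.

Lemma coord_bop i : exists v, forall x, v x = co x i.
Proof.
by have [C hC] := co_le i; apply: (bop_of_bound (f := co^~ i) (C := C)) => [c x y|].
Qed.

Lemma comp_bop v : exists w, forall x, w x = v (P x).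
Proof.
apply: (bop_of_bound (C := opnorm v)) => [c x y|x].
  by rewrite linearP/= linearP.
rewrite (le_trans (opnorm_le _ _))// ler_wpM2l//; exact: (normr_ge0 v).
Qed.

(** The j-th coordinate of [P] is a bounded functional, so it vanishes at [y] once it vanishes at
    the basis vectors in the support of [y]. *)
Lemma projection_disjoint x y : P x = x -> (forall i, co x i = 0 \/ co y i = 0) ->
  forall j, co x j = 0 \/ co (P y) j = 0.
Proof.
move=> Px xy j; have [xj|xj] := eqVneq (co x j) 0; [by left|right].
have [v hv] := coord_bop j; have [w hw] := comp_bop v.
rewrite -hv -hw; apply: bop_eq0 => i; rewrite hw hv.
case: (xy i) => [/(P_disjoint Px) /(_ j)|]; last by left.
by case=> [E|]; [rewrite E eqxx in xj|right].
Qed.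

(* [w := P y1 - y1] is disjoint from [x], hence from [y1], and [P] does not
   increase the norm of [y1]; evenness of [t |-> |y1 + t w|] and strict convexity
   force [w = 0]. *)
Lemma range_restriction x y : P x = x -> P y = y ->
  P (rs (supp x) y) = rs (supp x) y.
Proof.
move=> Px Py; set y1 := rs (supp x) y.
have y1E i : co y1 i = if co x i == 0 then 0 else co y i.
  by rewrite co_rs /supp; case: eqP.
have [w [wE xw]] : exists w : Z, P y1 = y1 + w /\ forall i, co x i = 0 \/ co w i = 0.
  exists (P y1 - y1); split; first by rewrite addrC subrK.
  have d2 : forall i, co x i = 0 \/ co (y - y1) i = 0.
    move=> k; rewrite coB y1E.
    by have [->|_] := eqVneq (co x k) 0; [left|right; rewrite subrr].
  have -> : P y1 - y1 = (y - y1) - P (y - y1).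
    by rewrite linearB Py opprB addrCA [y - y1 - y]addrAC subrr sub0r.
  move=> i; case: (d2 i) => E1; first by left.
  case: (projection_disjoint Px d2 i) => E2; first by left.
  by right; rewrite coB E1 E2 subrr.
have flip : `|y1 - w| = `|P y1|.
  rewrite wE -[RHS](rs_flip (supp x)); congr `|_|; apply: co_inj => i.
  rewrite !coB !co_rs !coD y1E /= /supp.
  have [xi|xi] := eqVneq (co x i) 0; first by rewrite !add0r.
  by case: (xw i) => [E|->]; [rewrite E eqxx in xi|rewrite addr0].
suff w0 : w = 0 by rewrite wE w0 addr0.
by apply: (rigid (m := y1)); rewrite ?flip -?wE P_le.
Qed.

(** On this set an element of the range is determined by its coordinate at [i]. The set also
    contains the indices where the whole range vanishes, which is why the blocks below are supports
    of elements of the range and not atoms. *)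
Definition atom i : I -> bool :=
  fun j => `[< forall y, P y = y -> co y i = 0 -> co y j = 0 >].

(** Each index outside the atom is in the support of some element of the range vanishing at [i].
    Deleting finitely many such supports from [x] stays in the range and leaves the atom untouched;
    the deletions approximate [u], and contractivity of [P] passes the fixed-point property to the
    limit. *)
Lemma range_atom x i : P x = x -> P (rs (atom i) x) = rs (atom i) x.
Proof.
move=> Px; set u := rs (atom i) x.
have [y hy] : {y : I -> Z & forall l, [/\ P (y l) = y l, co (y l) i = 0 &
    ~~ atom i l -> co (y l) l != 0]}.
  apply: (@choice _ _ (fun l z => [/\ P z = z, co z i = 0 &
    ~~ atom i l -> co z l != 0])) => l.
  have [il|/asboolP nil] := boolP (atom i l).
    by exists 0; split; [rewrite linear0|rewrite co0|].
  apply: contrapT => h; apply: nil => z Pz zi; apply: contrapT => zl.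
  by apply: h; exists z; split => // _; apply/eqP.
pose s (r : seq I) j := all (fun l => co (y l) j == 0) r.
have Ps r : P (rs (s r) x) = rs (s r) x.
  elim: r => [|l r IH].
    by rewrite (_ : rs _ x = x)//; apply: co_inj => j; rewrite co_rs.
  have -> : rs (s (l :: r)) x = rs (s r) x - rs (supp (y l)) (rs (s r) x).
    apply: co_inj => j; rewrite coB !co_rs /s/= /supp.
    by case: (co (y l) j == 0) => /=; rewrite ?subr0 ?subrr.
  by have [Pl _ _] := hy l; rewrite linearB/= IH range_restriction.
apply/eqP; rewrite -subr_eq0 -normr_le0; apply/ler_addgt0Pl => d d0; rewrite addr0.
have d2 : 0 < d / 2 by rewrite divr_gt0.
have [F hF] := rs_small x d2.
have near : `|rs (s (enum_fset F)) x - u| <= d / 2.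
  have -> : rs (s (enum_fset F)) x - u =
      rs (fun j => s (enum_fset F) j && ~~ atom i j) x.
    apply: co_inj => j; rewrite coB !co_rs.
    have [/asboolP ij|_] := boolP (atom i j); last by rewrite andbT subr0.
    rewrite andbF (_ : s _ j) ?subrr//.
    by apply/allP => l _; apply/eqP; have [Pl li _] := hy l; exact: ij.
  apply: hF => j jF; apply/negP => /andP[/allP/(_ j jF)/= yj nij].
  by have [_ _ /(_ nij)] := hy j; rewrite yj.
have near2 : `|P u - rs (s (enum_fset F)) x| <= d / 2.
  rewrite -Ps -linearB/=; apply: (le_trans (P_le _)).
  by rewrite distrC.
rewrite -[P u](subrK (rs (s (enum_fset F)) x)) -addrA.
by rewrite (le_trans (ler_normD _ _))// (splitr d) lerD.
Qed.

(** The combination of [x] and [y] that vanishes at [i] is in the range, so it vanishes on the whole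
    atom. *)
Lemma atom_span x y i j : P x = x -> P y = y -> co x i != 0 -> atom i j ->
  co y j = co y i / co x i * co x j.
Proof.
move=> Px Py xi /asboolP ij; apply/eqP; rewrite -subr_eq0; apply/eqP.
rewrite -coZ -coB; apply: ij.
  by rewrite linearB linearZ/= Px Py.
by rewrite coB coZ divfK ?subrr.
Qed.

(** [v] reads off the coefficient of elements of the range along [z]. The last clause, that [v] only
    sees the coordinates in [B], later makes the functionals disjoint. *)
Definition range_block (B : set I) z v : Prop :=
  [/\ P z = z, forall j, B j <-> co z j != 0, v z = 1,
      forall x, P x = x -> forall j, B j -> co x j = v x * co z j &
      forall x, (forall j, B j -> co x j = 0) -> v x = 0].

(** Take for [z] the restriction of [x] to the atom of [i], and for [v] the i-th coordinate divided
    by that of [z]. *)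
Lemma range_block_ex x i : P x = x -> co x i != 0 ->
  exists B z v, range_block B z v /\ B i.
Proof.
move=> Px xi; pose z := rs (atom i) x.
have ii : atom i i by apply/asboolP.
have zi : co z i = co x i by rewrite co_rs ii.
have zi0 : co z i != 0 by rewrite zi.
have Pz : P z = z by exact: range_atom.
have zat j : co z j != 0 -> atom i j.
  by rewrite co_rs; case: ifP => //; rewrite eqxx.
have [C hC] := co_le i.
have [v hv] : exists v : bop Z R, forall y, v y = (co z i)^-1 * co y i.
  apply: (bop_of_bound (C := `|(co z i)^-1| * C)) => [c y y'|y].
    by rewrite co_linear mulrDr mulrCA.
  by rewrite normrM -mulrA ler_wpM2l.
exists [set j | co z j != 0], z, v; split => //; split => //.
- by rewrite hv mulVf.
- move=> y Py j /= /zat ij; rewrite hv (atom_span Pz Py zi0 ij).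
  by congr (_ * _); exact: mulrC.
by move=> y /(_ i zi0) yi; rewrite hv yi mulr0.
Qed.

(** On [B] the vector [z'] equals [v z'] times [z], and this factor is nonzero because the blocks
    meet. By symmetry, blocks that meet coincide. *)
Lemma range_block_subset B z v B' z' v' j : range_block B z v ->
  range_block B' z' v' -> B j -> B' j -> B `<=` B'.
Proof.
move=> [Pz Bz _ hv _] [Pz' Bz' _ _ _] Bj B'j l Bl.
have h k : B k -> co z' k = v z' * co z k by exact: hv.
have v0 : v z' != 0.
  by apply: contraTneq ((Bz' j).1 B'j) => E; rewrite h// E mul0r eqxx.
by apply/Bz'; rewrite h// mulf_neq0//; apply/Bz.
Qed.

Lemma range_blocks : exists (D : set nat) (g : nat -> set I) (z : nat -> Z)
    (v : nat -> bop Z R),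
  [/\ D = setT \/ (exists n, D = `I_n),
      forall k, D k -> range_block (g k) (z k) (v k),
      forall k, ~ D k -> z k = 0 /\ v k = 0,
      forall k l j, D k -> D l -> g k j -> g l j -> k = l &
      forall x j, P x = x -> co x j != 0 -> exists2 k, D k & g k j].
Proof.
pose F : set (set I) := [set B | exists z v, range_block B z v /\ exists j, B j].
have cF : countable F.
  (* The block through [i]: a block is determined by any one of its indices, so there are no more
     blocks than indices. *)
  pose f i : set I := [set j | exists B z v, [/\ range_block B z v, B i & B j]].
  have Ff : F `<=` f @` setT.
    move=> B [z [v [hB [i Bi]]]]; exists i => //; apply/seteqP; split => j.
      move=> [B' [z' [v' [hB' B'i B'j]]]].
      exact: (range_block_subset hB' hB B'i Bi).
    by move=> Bj; exists B, z, v.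
  apply: card_le_trans (subset_card_le Ff) _.
  by apply: card_le_trans (card_image_le _ _) _; exact: countableP.
have [D [g [hD gF]]] : exists (D : set nat) g, (D = setT \/ exists n, D = `I_n) /\
    set_bij D F g.
  have [/finite_setP[n]|/infiniteP Finf] := pselect (finite_set F).
    rewrite card_eq_sym => /card_set_bijP[g hg].
    by exists `I_n, g; split => //; right; exists n.
  have : ([set: nat] #= F)%card by rewrite card_eq_le Finf; exact: cF.
  by move=> /card_set_bijP[g hg]; exists setT, g; split => //; left.
have [gin ginj gsurj] := gF.
(* Outside [D] both the vector and the functional are set to 0, so all of [nat] can index the
   averaging sum. *)
have [zv hzv] : {zv : nat -> Z * bop Z R & forall k,
    (D k -> range_block (g k) (zv k).1 (zv k).2) /\
    (~ D k -> (zv k).1 = 0 /\ (zv k).2 = 0)}.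
  apply: (@choice _ _ (fun k (zv : Z * bop Z R) =>
    (D k -> range_block (g k) zv.1 zv.2) /\ (~ D k -> zv.1 = 0 /\ zv.2 = 0))) => k.
  have [Dk|nDk] := pselect (D k); last by exists (0, 0); split.
  have [z [v [hb _]]] := gin _ Dk.
  by exists (z, v); split.
exists D, g, (fun k => (zv k).1), (fun k => (zv k).2); split => //.
- by move=> k Dk; exact: (hzv k).1.
- by move=> k Dk; exact: (hzv k).2.
- move=> k l j Dk Dl gk gl; apply: ginj; [exact: mem_set|exact: mem_set|].
  have h1 := (hzv k).1 Dk; have h2 := (hzv l).1 Dl.
  apply/seteqP; split.
    exact: range_block_subset h1 h2 gk gl.
  exact: range_block_subset h2 h1 gl gk.
move=> x j Px xj; have [B [z [v [hb Bj]]]] := range_block_ex Px xj.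
have [k Dk gk] : (g @` D) B by apply: gsurj; exists z, v; split => //; exists j.
by exists k => //; rewrite gk.
Qed.

Theorem averaging_and_block_basis :
  averaging_operator b P /\ admits_block_basis b (range P).
Proof.
have [D [g [z [v [hD hblock hout hdisj hcov]]]]] := range_blocks.
pose A k i := `[< D k >] && `[< g k i >].
have Adisj k l i : A k i -> A l i -> k = l.
  by move=> /andP[/asboolP Dk /asboolP gk] /andP[/asboolP Dl /asboolP gl]; exact: hdisj gk gl.
have Acov x : P x = x -> forall i, co x i != 0 -> exists k, A k i.
  by move=> Px i /(hcov _ _ Px)[k Dk gk]; exists k; apply/andP; split; apply/asboolP.
have Arange x k : P x = x -> rs (A k) x = v k x *: z k.
  move=> Px; have [Dk|nDk] := pselect (D k); last first.
    have [-> ->] := hout _ nDk.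
    by rewrite scaler0; apply: co_inj => j; rewrite co_rs co0 /A (asboolF nDk).
  have [_ gz _ hv _] := hblock _ Dk.
  apply: co_inj => j; rewrite co_rs coZ /A; have [gj|gj] := pselect (g k j).
    by rewrite (asboolT Dk) (asboolT gj) /= (hv _ Px _ gj).
  rewrite (asboolF gj) andbF (_ : co (z k) j = 0) ?mulr0//.
  by apply: contrapT => /eqP zj; apply: gj; apply/gz.
have zsupp k i : co (z k) i != 0 -> D k /\ g k i.
  move=> zi; have [Dk|/hout[zk _]] := pselect (D k); last by rewrite zk co0 eqxx in zi.
  by split => //; have [_ gz _ _ _] := hblock _ Dk; apply/gz.
have zdisj k l : k != l -> forall i, co (z k) i = 0 \/ co (z l) i = 0.
  move=> kl i; have [|/zsupp[Dk gk]] := eqVneq (co (z k) i) 0; first by left.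
  have [|/zsupp[Dl gl]] := eqVneq (co (z l) i) 0; first by right.
  by rewrite (hdisj _ _ _ Dk Dl gk gl) eqxx in kl.
have v0 k x : (forall i, co (z k) i = 0 \/ co x i = 0) -> v k x = 0.
  move=> zx; have [Dk|/hout[_ ->]//] := pselect (D k).
  have [_ gz _ _ hv] := hblock _ Dk; apply: hv => i /gz zi.
  by case: (zx i) => // E; rewrite E eqxx in zi.
have zP k : P (z k) = z k.
  have [/hblock[]//|/hout[-> _]] := pselect (D k); exact: linear0.
have range_fix x : range P x -> P x = x by move=> [y _ <-]; exact: PP.
split.
(* The averaging functionals are the block functionals composed with [P]. *)
- have [w hw] : {w : nat -> bop Z R & forall k x, w k x = v k (P x)}.
    apply: (@choice _ _ (fun k (w : bop Z R) => forall x, w x = v k (P x))) => k.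
    exact: comp_bop.
  exists nat, z, w; split => //.
  + by move=> k l kl; apply/disjoint_inP => i; rewrite !coordE; exact: zdisj.
  + move=> k l kl; apply: dual_disjointP => i; rewrite !hw.
    (* If [z k] vanishes at [i], then [P (b i)] is disjoint from [z k], so [v k] annihilates it. *)
    by case: (zdisj k l kl i) => zi; [left|right]; apply: v0; exact: P_disjoint.
  + by move=> k l kl; rewrite hw zP; apply: v0; exact: zdisj.
  + move=> x; have := sums_to_cover Adisj (Acov _ (PP x)).
    rewrite (_ : (fun k => rs (A k) (P x)) = fun k => w k x *: z k)//.
    by apply/funext => k; rewrite hw -Arange.
- exists D, z; split => //; last first.
    by move=> k l _ _ kl; apply/disjoint_inP => i; rewrite !coordE; exact: zdisj.
  split; first by move=> k /hblock[Pz _ _ _ _]; exists (z k).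
  move=> x /range_fix Px; exists (fun k => v k x); split.
    split; first by move=> k /hout[_ ->].
    have := series_cover Adisj (Acov _ Px).
    rewrite (_ : (fun k => rs (A k) x) = fun k => v k x *: z k)//.
    by apply/funext => k; exact: Arange.
  move=> a [a0 ax]; apply/funext => k.
  have [Dk|nDk] := pselect (D k); last by rewrite a0// (hout _ nDk).2.
  (* Uniqueness: the continuous [v k] annihilates every other block vector, so it extracts the k-th
     coefficient of any expansion of [x]. *)
  have l1 : (fun n => v k (series (fun l => a l *: z l) n)) @ \oo --> v k x.
    exact: (@cvg_comp _ _ _ _ (v k) _ _ _ ax (@bop_continuous _ _ _ (v k) x)).
  have l2 : (fun n => v k (series (fun l => a l *: z l) n)) @ \oo --> a k.
    apply: cvg_near_cst; exists k.+1 => // n /= kn.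
    rewrite /series/= linear_sum (bigD1_seq k) ?mem_index_iota ?iota_uniq//=.
    have [_ _ vz _ _] := hblock _ Dk.
    rewrite linearZ/= vz big1 ?addr0 => [|l lk]; first exact: mulr1.
    by rewrite linearZ/= v0 ?scaler0// => i; apply: zdisj; rewrite eq_sym.
  exact: cvg_unique l1 l2.
Qed.

End unconditional_projection.

(** * Application of the abstract result to the coordinates of lp(X) *)

Theorem theorem4p11 (R : realType) (p : R) (p1 : 1 < p) (p2 : p < 2)
    (X : completeNormedModType R) (J : countType) (e : J -> X)
    (e_basis : one_unconditional_basis e)
    (X_C2 : C2_smooth X)
    (X_reflects : reflects_disjointness e)
    (X_D2_bounded : bounded_second_derivative_on_sphere X)
    (P : {linear lpseq X (ltW p1) -> lpseq X (ltW p1)})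
    (P_proj : contractive_projection P) :
  averaging_operator (lp_basis (ltW p1) e) P /\
  admits_block_basis (lp_basis (ltW p1) e) (range P).
Proof.
apply: (@averaging_and_block_basis R (lpseq X (ltW p1)) _ (lp_basis (ltW p1) e)
  (@lp_coord R p p1 X J e) (@lp_restr R p p1 X J e e_basis)).
- exact: lp_coord_linear.
- exact: lp_coord_inj.
- exact: lp_coord_restr.
- exact: lp_norm_flip.
- exact: lp_restr_small.
- exact: lp_coord_delta.
- by move=> i; exists `|e i.2|^-1 => x; exact: lp_coord_le.
- exact: (lp_rigid p2 e_basis X_C2 X_reflects X_D2_bounded).
- exact: P_proj.
move=> x i Px xi.
exact: (range_disjoint_basis p2 e_basis X_C2 X_reflects X_D2_bounded P_proj).
Qed.
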